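(* Let $G$ be a subgroup of $\mathrm{Homeo}(\mathbb{T})$, the group of homeomorphisms of the circle $\mathbb{T}=\mathbb{R}/\mathbb{Z}$. If $G$ does not contain a free subgroup on two generators, then there is a $G$-invariant Borel probability measure on $\mathbb{T}$.
   Context: ''A free subgroup on two generators'' means a subgroup isomorphic to the non-abelian free group of rank two. A probability measure $\mu$ on $\mathbb{T}$ is $G$-invariant if $\mu(gA)=\mu(A)$ for every $g\in G$ and every Borel set $A\subset\mathbb{T}$. *)

(* Defs.v *)
From HB Require Import structures.
From mathcomp Require Import all_boot all_order all_algebra.
From mathcomp Require Import all_classical all_reals all_analysis.

Set Implicit Arguments.
Unset Strict Implicit.
Unset Printing Implicit Defensive.

Import Order.TTheory GRing.Theory Num.Theory.
Import numFieldNormedType.Exports.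

Section Circle.
Variable R : realType.
Local Open Scope ring_scope.

Definition int_congr (x y : R) : bool := x - y \is a Num.int.

Lemma int_congr_refl : reflexive int_congr.
Proof. by move=> x; rewrite /int_congr subrr. Qed.

Lemma int_congr_sym : symmetric int_congr.
Proof. by move=> x y; rewrite /int_congr -opprB rpredN. Qed.

Lemma int_congr_trans : transitive int_congr.
Proof. by move=> y x z xy yz; rewrite /int_congr -(subrKA y) rpredD. Qed.

Canonical int_congr_equiv :=
  EquivRel int_congr int_congr_refl int_congr_sym int_congr_trans.

Definition circle : Type := quotient_topology {eq_quot int_congr_equiv}%qT.
HB.instance Definition _ :=
  PointedTopological.copy circle (quotient_topology {eq_quot int_congr_equiv}%qT).
HB.instance Definition _ :=
  Quotient.copy circle (quotient_topology {eq_quot int_congr_equiv}%qT).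

End Circle.

Notation borel T := (g_sigma_algebraType (@open T)).

Section Homeo.
Variable T : topologicalType.

Record homeo : Type := Homeo {
  homeo_fun :> T -> T;
  homeo_inv : T -> T;
  homeo_funK : cancel homeo_fun homeo_inv;
  homeo_invK : cancel homeo_inv homeo_fun;
  homeo_fun_continuous : continuous homeo_fun;
  homeo_inv_continuous : continuous homeo_inv }.

HB.instance Definition _ := gen_eqMixin homeo.
HB.instance Definition _ := gen_choiceMixin homeo.

Lemma homeoP (f g : homeo) : f =1 g -> f = g.
Proof.
case: f g => [f f' fK f'K cf cf'] [g g' gK g'K cg cg'] /= /funext fg.
subst g; have f'g' : f' = g' by apply/funext => x; rewrite -[in LHS](g'K x) fK.
by subst g'; congr Homeo; exact: Prop_irrelevance.
Qed.

Definition homeo_id : homeo :=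
  @Homeo idfun idfun (fun=> erefl) (fun=> erefl)
    (fun=> cvg_id) (fun=> cvg_id).

Definition homeo_sym (f : homeo) : homeo :=
  Homeo (@homeo_invK f) (@homeo_funK f)
    (@homeo_inv_continuous f) (@homeo_fun_continuous f).

Lemma continuous_comp_fun (f g : T -> T) :
  continuous f -> continuous g -> continuous (f \o g).
Proof. by move=> cf cg x; apply: continuous_comp; [exact: cg|exact: cf]. Qed.

Definition homeo_comp (f g : homeo) : homeo :=
  Homeo (can_comp (@homeo_funK f) (@homeo_funK g))
    (can_comp (@homeo_invK g) (@homeo_invK f))
    (continuous_comp_fun (@homeo_fun_continuous f) (@homeo_fun_continuous g))
    (continuous_comp_fun (@homeo_inv_continuous g) (@homeo_inv_continuous f)).

Lemma homeo_compA : associative homeo_comp.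
Proof. by move=> f g h; exact: homeoP. Qed.

Lemma homeo_comp1f : left_id homeo_id homeo_comp.
Proof. by move=> f; exact: homeoP. Qed.

Lemma homeo_compf1 : right_id homeo_id homeo_comp.
Proof. by move=> f; exact: homeoP. Qed.

Lemma homeo_compVf : left_inverse homeo_id homeo_sym homeo_comp.
Proof. by move=> f; apply: homeoP => x /=; exact: homeo_funK. Qed.

Lemma homeo_compfV : right_inverse homeo_id homeo_sym homeo_comp.
Proof. by move=> f; apply: homeoP => x /=; exact: homeo_invK. Qed.

HB.instance Definition _ := isGroup.Build homeo homeo_compA homeo_comp1f
  homeo_compf1 homeo_compVf homeo_compfV.

End Homeo.

(* The free group on X, realised as the reduced words in the letters x (coded *)
(* by (x, true)) and x^-1 (coded by (x, false)), multiplied by concatenation  *)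
(* followed by reduction.                                                     *)
Section FreeGroup.
Variable X : choiceType.

Definition letter_inv (a : X * bool) : X * bool := (a.1, ~~ a.2).

Definition reduced (w : seq (X * bool)) : bool :=
  sorted (fun a b => b != letter_inv a) w.

Definition reduced_cons (a : X * bool) (w : seq (X * bool)) :=
  if w is b :: w' then (if b == letter_inv a then w' else a :: w) else [:: a].

Definition word_mul (u v : seq (X * bool)) := foldr reduced_cons v u.

Definition word_inv (u : seq (X * bool)) := rev (map letter_inv u).

Record free_group : Type := FreeGroup {
  word :> seq (X * bool);
  word_reduced : reduced word }.

HB.instance Definition _ := [isSub for word].
HB.instance Definition _ := [Choice of free_group by <:].

Lemma letter_invK : involutive letter_inv.
Proof. by case=> x b; rewrite /letter_inv /= negbK. Qed.

Lemma reduced_cons_reduced a w : reduced w -> reduced (reduced_cons a w).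
Proof.
case: w => [|b w] //= rbw; case: ifPn => [_|ba /=]; first exact: path_sorted rbw.
by rewrite ba.
Qed.

Lemma reduced_consE a w : reduced (a :: w) -> reduced_cons a w = a :: w.
Proof. by case: w => [|b w] //= /andP[/negPf->]. Qed.

Lemma reduced_consK a w :
  reduced w -> reduced_cons (letter_inv a) (reduced_cons a w) = w.
Proof.
case: w => [_|b w rbw] /=; first by rewrite letter_invK eqxx.
case: ifPn => [/eqP <-|_]; first exact: reduced_consE.
by rewrite /= letter_invK eqxx.
Qed.

Lemma reduced_consVK a w :
  reduced w -> reduced_cons a (reduced_cons (letter_inv a) w) = w.
Proof. by move=> /(reduced_consK (letter_inv a)); rewrite letter_invK. Qed.

Lemma word_mul_reduced u v : reduced v -> reduced (word_mul u v).
Proof. by move=> rv; elim: u => //= a u; exact: reduced_cons_reduced. Qed.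

Lemma word_mul_cons a v w : reduced w ->
  word_mul (reduced_cons a v) w = reduced_cons a (word_mul v w).
Proof.
case: v => [|b v] //= rw; case: eqP => [->|//].
by rewrite reduced_consVK //; exact: word_mul_reduced.
Qed.

Lemma word_mulA u v w : reduced w ->
  word_mul u (word_mul v w) = word_mul (word_mul u v) w.
Proof. by move=> rw; elim: u => //= a u ->; rewrite word_mul_cons. Qed.

Lemma word_mulw1 u : reduced u -> word_mul u [::] = u.
Proof.
elim: u => //= a u IHu rau.
by rewrite IHu ?reduced_consE //; exact: path_sorted rau.
Qed.

Lemma word_mulKw u w : reduced w -> word_mul (word_inv u) (word_mul u w) = w.
Proof.
move=> rw; elim: u => //= a u IHu.
rewrite /word_inv /= rev_cons /word_mul foldr_rcons reduced_consK //.
exact: word_mul_reduced.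
Qed.

Lemma word_invK : involutive word_inv.
Proof.
by move=> u; rewrite /word_inv map_rev revK -map_comp map_id_in // => a _ /=;
  rewrite letter_invK.
Qed.

Lemma word_inv_reduced u : reduced u -> reduced (word_inv u).
Proof.
rewrite /word_inv /reduced rev_sorted sorted_map => ru.
apply: sub_sorted ru => a b /=; apply: contraNN => /eqP ab.
by rewrite -[b]letter_invK ab; apply/eqP; rewrite !letter_invK.
Qed.

Definition free_group_one : free_group := @FreeGroup [::] isT.

Definition free_group_mul (u v : free_group) : free_group :=
  FreeGroup (word_mul_reduced u (word_reduced v)).

Definition free_group_inv (u : free_group) : free_group :=
  FreeGroup (word_inv_reduced (word_reduced u)).

Lemma free_group_mulA : associative free_group_mul.
Proof. by move=> u v w; apply/val_inj/word_mulA/word_reduced. Qed.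

Lemma free_group_mul1w : left_id free_group_one free_group_mul.
Proof. by move=> u; exact: val_inj. Qed.

Lemma free_group_mulw1 : right_id free_group_one free_group_mul.
Proof. by move=> u; apply/val_inj/word_mulw1/word_reduced. Qed.

Lemma free_group_mulVw : left_inverse free_group_one free_group_inv free_group_mul.
Proof.
move=> u; apply: val_inj => /=.
by rewrite -[X in word_mul _ X](word_mulw1 (word_reduced u)) word_mulKw.
Qed.

Lemma free_group_mulwV : right_inverse free_group_one free_group_inv free_group_mul.
Proof.
move=> u; rewrite -[X in free_group_mul X _](_ : free_group_inv (free_group_inv u) = u).
  exact: free_group_mulVw.
exact/val_inj/word_invK.
Qed.

HB.instance Definition _ := isGroup.Build free_group free_group_mulA
  free_group_mul1w free_group_mulw1 free_group_mulVw free_group_mulwV.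

End FreeGroup.

Section FreeSubgroup.
Variable gT : groupType.
Local Open Scope classical_set_scope.

Definition free_of_rank2 (H : groupClosed gT) : Prop :=
  exists phi : {multiplicative free_group 'I_2 -> gT},
    set_bij [set: free_group 'I_2] [set` H] phi.

Definition contains_free_subgroup2 (G : groupClosed gT) : Prop :=
  exists H : groupClosed gT, {subset H <= G} /\ free_of_rank2 H.

End FreeSubgroup.

Definition invariant_measure (R : realType) (T : ptopologicalType)
    (G : groupClosed (homeo T)) (mu : probability (borel T) R) : Prop :=
  forall g : homeo T, g \in G ->
  forall A : set (borel T), measurable A -> mu (g @` A)%classic = mu A.

(* Main.v *)
(* Lift the orientation-preserving elements of G to increasing bijections of R *)
(* commuting with x |-> x + 1.  Suppose that every orbit on the circle is      *)
(* infinite (averaging over a finite orbit settles the other case).  For an    *)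
(* interval J whose translates have lengths bounded below, count the maximal   *)
(* number N_J(x, y) of disjoint translates of J inside [x, y]: this is exactly *)
(* invariant, and additive up to an error of 1.  If N_J(0, 1) is unbounded, an *)
(* ultralimit of N_J / N_J(0, 1) is an invariant distribution function, hence  *)
(* an invariant Stieltjes measure.  Otherwise every sufficiently short         *)
(* interval can be contracted to arbitrarily small length.  In the pointwise   *)
(* closure of the lifts, on each grid of mesh 1/M, a map for which the number  *)
(* of grid cells that can never be collapsed is maximal can be composed so     *)
(* that it collapses all other cells; that number is bounded independently of  *)
(* M.  Letting M tend to infinity produces finite sets A, B such that elements *)
(* of G map the complement of any neighbourhood of A into any neighbourhood of *)
(* B.  B. H. Neumann's separation of finite sets along infinite orbits makes   *)
(* B disjoint from A, and then makes a conjugate of the resulting element play *)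
(* ping-pong with it.  Orientation-reversing elements are dealt with by        *)
(* averaging over the two cosets.                                              *)

From HB Require Import structures.
Require Import Defs.
From mathcomp Require Import all_boot all_order all_algebra.
From mathcomp Require Import all_classical all_reals all_analysis.
From mathcomp Require Import measurable_realfun.
From mathcomp Require Import zify ring lra.

Set Implicit Arguments.
Unset Strict Implicit.
Unset Printing Implicit Defensive.

Import Order.TTheory GRing.Theory Num.Theory.
Import numFieldNormedType.Exports.

Local Open Scope classical_set_scope.
Local Open Scope ring_scope.

(** The proof is an alternative between an invariant measure and a contraction strong enough for
    ping-pong. It is run for the orientation-preserving subgroup [H] of [G], through the group
    [lifts] of increasing lifts to the line. If [H] has a finite orbit, counting measure on it is
    invariant ([finite_orbit_invariant]). Suppose that all orbits are infinite.

    If arbitrarily short intervals resist contraction, they accumulate at a point z, and the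
    translates of any fixed neighbourhood of z have lengths bounded below. Since the orbit of z is
    infinite, packings of [0, 1] by translates of ever smaller neighbourhoods of z have unbounded
    size; the normalised packing numbers converge along an ultrafilter to an invariant distribution
    function ([contractible_small], [quasi_additive_limit]), whose Stieltjes measure descends to the
    circle ([cdf_invariant]).

    Otherwise all intervals of length at most some l can be contracted. A pointwise limit of lifts
    with the most non-collapsible grid cells can be composed until it collapses all the others, and
    at most 1/l cells survive, whatever the mesh ([collapse_cells], [card_rigid_cells]). As the mesh
    shrinks, the surviving cells and the values taken elsewhere accumulate at finite sets A and B
    ([quasi_contraction]). [orbit_separation] moves B off A, and then the union of A and B off
    itself, which yields a ping-pong pair ([free_subgroup], [ping_pong]).

    A product of two orientation-reversing elements preserves orientation, so a sum over two cosets
    passes from [H] to [G] ([index2_invariant]). *)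

(** * Limits of real sequences along a free ultrafilter *)

Section UltraLimit.
Variables (R : realType) (U : set_system nat).
Hypothesis UU : UltraFilter U.
Hypothesis Uoo : \oo `<=` U.

Definition ulim (u : nat -> R) (p : R) :=
  forall e : R, 0 < e -> U [set n | `|u n - p| < e].

(** Compactness gives a cluster point, and along an ultrafilter a cluster point is a limit. *)
Lemma ulim_ex (a b : R) (u : nat -> R) :
  (forall n, a <= u n <= b) -> exists2 p, a <= p <= b & ulim u p.
Proof.
move=> uab.
have : (u @ U) `[a, b]%classic.
  by apply: (@filterS _ U _ setT) => [n _|]; [rewrite /= in_itv/= uab|exact: filterT].
move=> /(@segment_compact R a b _ _)[p [pab cp]].
exists p; first by move: pab; rewrite /= in_itv.
move=> e e0; have [//|Un] := in_ultra_setVsetC [set n | `|u n - p| < e] UU.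
have [] := cp (~` [set x | `|x - p| < e]) (ball p e); [exact: Un|exact: nbhsx_ballx|].
by move=> x [/=]; rewrite -ball_normE/= distrC.
Qed.

Lemma ulim_small e : 0 < e -> U [set n | n.+1%:R^-1 < e :> R].
Proof. by move=> e0; apply: Uoo; exact: near_infty_natSinv_lt (PosNum e0). Qed.

Lemma ulim_eq (u v : nat -> R) p q : ulim u p -> ulim v q ->
  (forall e : R, 0 < e -> U [set n | `|u n - v n| < e]) -> p = q.
Proof.
move=> up vq uv; apply/eqP; rewrite -subr_eq0 -normr_le0 leNgt; apply/negP => pq.
have e0 : 0 < `|p - q| / 4 by lra.
have [n [[/=]]] : [set n | `|u n - p| < `|p - q| / 4] `&`
    [set n | `|v n - q| < `|p - q| / 4] `&`
    [set n | `|u n - v n| < `|p - q| / 4] !=set0.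
  exact: filter_ex (filterI (filterI (up _ e0) (vq _ e0)) (uv _ e0)).
move=> h1 h2 h3; move: pq h1 h2 h3.
rewrite -(distrC p (u n)); have -> : p - q = (p - u n) + (u n - v n) + (v n - q) by ring.
set P := p - u n; set Q := u n - v n; set T := v n - q => h0.
have := ler_normD (P + Q) T; have := ler_normD P Q; lra.
Qed.

Lemma ulimD (u v : nat -> R) p q : ulim u p -> ulim v q ->
  ulim (fun n => u n + v n) (p + q).
Proof.
move=> up vq e e0; have e2 : 0 < e / 2 by lra.
apply: filterS (filterI (up _ e2) (vq _ e2)) => n [/= h1 h2].
have -> : u n + v n - (p + q) = (u n - p) + (v n - q) by ring.
by have := ler_normD (u n - p) (v n - q); lra.
Qed.

Lemma ulim_cst (c : R) : ulim (fun=> c) c.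
Proof.
move=> e e0; apply: (@filterS _ U _ setT) => [n _|]; last exact: filterT.
by rewrite /= subrr normr0.
Qed.

Lemma ulim_ge (u : nat -> R) c p : (forall n, c <= u n) -> ulim u p -> c <= p.
Proof.
move=> uc up; rewrite leNgt; apply/negP => cp.
have e0 : 0 < c - p by rewrite subr_gt0.
have [n /=] := filter_ex (up _ e0).
by rewrite ltr_norml; have := uc n; lra.
Qed.

End UltraLimit.

Lemma free_ultrafilter : exists2 U : set_system nat, UltraFilter U & \oo `<=` U.
Proof. by have [U [UU sU]] := ultraFilterLemma eventually_filter; exists U. Qed.

(** * Groups of increasing bijections of the line commuting with integer translations *)

Record lift_group (R : realType) (L : set (R -> R)) : Prop := {
  lg_mono : forall f, L f -> {mono f : x y / x < y};
  lg_per : forall f, L f -> forall x, f (x + 1) = f x + 1;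
  lg_comp : forall f g, L f -> L g -> L (f \o g);
  lg_inv : forall f, L f -> exists2 f', L f' & cancel f f' /\ cancel f' f;
  lg_trans : forall j : int, L (fun x => x + j%:~R) }.

Lemma per_int (R : realType) (f : R -> R) (j : int) x :
  (forall x, f (x + 1) = f x + 1) -> f (x + j%:~R) = f x + j%:~R.
Proof.
move=> fper; elim/int_rect: j => [|n IH|n IH]; first by rewrite mulr0z !addr0.
  by rewrite -addn1 PoszD intrD !addrA fper IH.
have := fper (x + (- n.+1%:Z)%:~R); rewrite -addrA.
have -> : (- n.+1%:Z)%:~R + 1 = (- n%:Z)%:~R :> R.
  by rewrite -addn1 PoszD opprD intrD subrK.
rewrite IH -addn1 PoszD opprD intrD => h; lra.
Qed.

Section Dynamics.
Variables (R : realType) (L : set (R -> R)).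
Hypothesis HL : lift_group L.

Lemma lg_le f : L f -> {mono f : x y / x <= y}.
Proof. by move=> Lf x y; rewrite !leNgt (lg_mono HL). Qed.

Lemma lg_cont f x e : L f -> 0 < e ->
  exists2 d, 0 < d & forall y, `|y - x| < d -> `|f y - f x| < e.
Proof.
move=> Lf e0; have [g Lg [fg gf]] := lg_inv HL Lf.
have h1 : g (f x - e) < x by rewrite -[ltRHS]fg (lg_mono HL Lg); lra.
have h2 : x < g (f x + e) by rewrite -[ltLHS]fg (lg_mono HL Lg); lra.
exists (Num.min (x - g (f x - e)) (g (f x + e) - x)).
  by rewrite lt_min; apply/andP; split; lra.
move=> y; rewrite lt_min => /andP[].
rewrite !ltr_norml => /andP[y1 _] /andP[_ y2].
have : f (g (f x - e)) < f y by rewrite (lg_mono HL Lf); lra.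
have : f y < f (g (f x + e)) by rewrite (lg_mono HL Lf); lra.
by rewrite !gf; lra.
Qed.

(** * Invariant distribution functions from quasi-additive counts *)

Definition invariant_cdf (F : R -> R) :=
  [/\ {homo F : x y / x <= y}, forall x, F (x + 1) = F x + 1 &
      forall f, L f -> exists c, forall x, F (f x) = F x + c].

Lemma exists_int_shift (x : R) : exists j : int, 0 <= x + j%:~R < 1.
Proof.
exists (- Num.floor x); rewrite rmorphN/=.
by have := floor_le x; have := floorD1_gt x; rewrite intrD/=; lra.
Qed.

(** Dividing by [N n 0 1] shrinks the additivity defect to at most 1/(n+1), so the ultralimit [M] is
    exactly additive and still invariant; [F] is its primitive from 0. *)
Lemma quasi_additive_limit (N : nat -> R -> R -> nat) :
  (forall n f x y, L f -> x <= y -> N n (f x) (f y) = N n x y) ->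
  (forall n x y z, x <= y -> y <= z ->
     (N n x y + N n y z <= N n x z <= N n x y + N n y z + 1)%N) ->
  (forall n, (n < N n 0%R 1%R)%N) ->
  exists F, invariant_cdf F.
Proof.
move=> Ninv Nadd Nbig; have [U UU Uoo] := free_ultrafilter.
pose D n : R := (N n 0 1)%:R; pose m x y n : R := (N n x y)%:R / D n.
have D1 n : 1 <= D n by rewrite /D ler1n; exact: leq_ltn_trans (Nbig n).
have Dgt0 n : 0 < D n by have := D1 n; lra.
have DV n : (D n)^-1 <= n.+1%:R^-1.
  by rewrite lef_pV2 ?posrE// ler_nat.
have trN n x y (j : int) : x <= y -> N n (x + j%:~R) (y + j%:~R) = N n x y.
  by move=> xy; exact: (Ninv n _ x y (lg_trans HL j)).
have N0 n x : N n x x = 0%N.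
  have /andP[h _] := Nadd n x x x (lexx _) (lexx _).
  by apply/eqP; rewrite -leqn0 -(leq_add2l (N n x x)) addn0.
have Nmon n x y x' y' : x' <= x -> x <= y -> y <= y' -> (N n x y <= N n x' y')%N.
  move=> h1 h2 h3; have /andP[g1 _] := Nadd n _ _ _ h1 (le_trans h2 h3).
  have /andP[g2 _] := Nadd n _ _ _ h2 h3.
  apply: leq_trans g1; apply: leq_trans (leq_addl _ _).
  by apply: leq_trans g2; exact: leq_addr.
have Nint n p : (N n 0%R p%:R <= p * (N n 0%R 1%R + 1))%N.
  elim: p => [|p IH]; first by rewrite N0.
  have p1 : p%:R <= p.+1%:R :> R by rewrite ler_nat.
  have /andP[_ h] := Nadd n _ _ _ (ler0n R p) p1.
  apply: leq_trans h _; rewrite mulSn -addnA addnC leq_add//.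
  have := trN n 0 1 p%:Z ler01; rewrite add0r -pmulrn.
  by rewrite -natr1 addrC => ->.
have mb x y : x <= y -> exists B, forall n, 0 <= m x y n <= B.
  move=> xy; pose j := Num.floor x.
  have [p yp] : exists p : nat, y - j%:~R <= p%:R.
    exists (Num.bound (y - j%:~R)); apply/ltW/archi_boundP.
    by rewrite subr_ge0 (le_trans _ xy)// floor_le.
  (* The factor 2 bounds [(D n + 1) / D n], as [1 <= D n]. *)
  exists (p%:R * 2) => n; rewrite /m divr_ge0//=.
  rewrite ler_pdivrMr//.
  have h1 : (N n x y <= N n 0%R p%:R)%N.
    rewrite -(trN n x y (- j))// rmorphN/=; apply: Nmon => //.
      by rewrite subr_ge0 floor_le.
    by rewrite lerB.
  have : (N n x y <= p * (N n 0%R 1%R + 1))%N by apply: leq_trans h1 (Nint n p).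
  rewrite -(ler_nat R) natrM natrD -/(D n) => /le_trans; apply.
  by rewrite -mulrA ler_wpM2l//; have := D1 n; lra.
have [M HM] : exists M : R -> R -> R, forall x y, x <= y -> ulim U (m x y) (M x y).
  have /choice[M HM] : forall xy : R * R, exists p, xy.1 <= xy.2 ->
      ulim U (m xy.1 xy.2) p.
    move=> [x y]; have [xy|] := pselect (x <= y); last by exists 0.
    by have [B /(ulim_ex UU)[p _ up]] := mb _ _ xy; exists p.
  by exists (fun x y => M (x, y)) => x y; exact: (HM (x, y)).
have Madd x y z : x <= y -> y <= z -> M x z = M x y + M y z.
  move=> xy yz; apply: (ulim_eq UU (HM _ _ (le_trans xy yz)) (ulimD UU (HM _ _ xy) (HM _ _ yz))).
  move=> e e0; apply: filterS (ulim_small Uoo e0) => n /= ne.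
  apply: le_lt_trans ne; apply: le_trans (DV n).
  have /andP[] := Nadd n _ _ _ xy yz; rewrite -!(ler_nat R) !natrD => h1 h2.
  rewrite /m -mulrDl -mulrBl normrM normfV (gtr0_norm (Dgt0 n)).
  apply: ler_piMl; first by rewrite invr_ge0 ltW.
  by rewrite ler_norml; lra.
have Minv f x y : L f -> x <= y -> M (f x) (f y) = M x y.
  move=> Lf xy; have fxy : f x <= f y by rewrite lg_le.
  apply: (ulim_eq UU (HM _ _ fxy) (HM _ _ xy)) => e e0.
  apply: (@filterS _ U _ setT) => [n _|]; last exact: filterT.
  by rewrite /= /m Ninv// subrr normr0.
have Mge0 x y : x <= y -> 0 <= M x y.
  move=> xy; apply: (ulim_ge UU _ (HM _ _ xy)) => n.
  by rewrite /m divr_ge0// ltW.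
have M01 : M 0 1 = 1.
  apply: (ulim_eq UU (HM _ _ ler01) (ulim_cst UU 1)) => e e0.
  apply: (@filterS _ U _ setT) => [n _|]; last exact: filterT.
  by rewrite /= /m -/(D n) divff ?subrr ?normr0// gt_eqF.
have M1 x : M x (x + 1) = 1.
  have [j /andP[j0 j1]] := exists_int_shift x.
  have := Minv _ x (x + 1) (lg_trans HL j); rewrite addrAC => <-; last by lra.
  set y := x + j%:~R in j0 j1 *.
  (* The interval from y to y + 1 is cut at 1, and its right piece is moved back to start at 0. *)
  rewrite (Madd y 1 (y + 1)); [|lra|lra].
  have := Minv _ 0 y (lg_trans HL 1) j0; rewrite /= add0r => ->.
  by rewrite addrC -(Madd 0 y 1) ?(ltW j1).
pose F x := if 0 <= x then M 0 x else - M x 0.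
have FM x y : x <= y -> F y - F x = M x y.
  move=> xy; rewrite /F; case: (leP 0 x) => x0; case: (leP 0 y) => y0.
  - by rewrite (Madd 0 x y)//; lra.
  - by have := lt_le_trans y0 (le_trans x0 xy); rewrite ltxx.
  - by rewrite (Madd x 0 y) ?(ltW x0)//; lra.
  - by rewrite (Madd x y 0) ?(ltW y0)//; lra.
exists F; split.
- by move=> x y xy; rewrite -subr_ge0 FM// Mge0.
- by move=> x; have := FM x (x + 1); rewrite M1; lra.
- move=> f Lf; exists (F (f 0) - F 0) => x.
  have [x0|/ltW x0] := leP 0 x.
    have fx : f 0 <= f x by rewrite lg_le.
    by have := FM _ _ x0; have := FM _ _ fx; rewrite Minv//; lra.
  have fx : f x <= f 0 by rewrite lg_le.
  by have := FM _ _ x0; have := FM _ _ fx; rewrite Minv//; lra.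
Qed.

(** * Packing an interval with disjoint translates of another *)

Section Packing.
Variables a b : R.

Fixpoint pack (k : nat) (x y : R) : Prop :=
  if k is k'.+1 then exists f, [/\ L f, x <= f a & pack k' (f b) y]
  else x <= y.

Lemma pack_extendl k x x' y : x' <= x -> pack k x y -> pack k x' y.
Proof.
case: k => [|k] /= h; first exact: le_trans.
by move=> [f [Lf xf fy]]; exists f; split => //; exact: le_trans xf.
Qed.

Lemma pack_cat k l x y z : pack k x y -> pack l y z -> pack (k + l) x z.
Proof.
elim: k x => [x|k IH x] /= xy yz; first exact: pack_extendl yz.
by case: xy => f [Lf xf fy]; exists f; split => //; exact: IH.
Qed.

(** Cutting at y destroys at most the one translate that straddles y. *)
Lemma pack_split k x y z : x <= y -> y <= z -> pack k x z ->
  exists i j, [/\ pack i x y, pack j y z & (k <= i + j + 1)%N].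
Proof.
elim: k x => [x|k IH x] xy yz /=; first by exists 0%N, 0%N.
move=> [f [Lf xf fz]]; have [fy|yf] := leP (f b) y.
  have [i [j [h1 h2 h3]]] := IH _ fy yz fz.
  by exists i.+1, j; split; [exists f|by []|rewrite !addSn].
exists 0%N, k; split => //; last by rewrite add0n addn1.
exact: pack_extendl (ltW yf) fz.
Qed.

Lemma pack_act g k x y : L g -> pack k x y -> pack k (g x) (g y).
Proof.
move=> Lg; elim: k x => [x|k IH x] /=; first by rewrite lg_le.
move=> [f [Lf xf fy]]; exists (g \o f); split; [exact: lg_comp|by rewrite /= lg_le|exact: IH].
Qed.

Lemma pack_bound d k x y : (forall f, L f -> d <= f b - f a) ->
  pack k x y -> k%:R * d <= y - x.
Proof.
move=> Hd; elim: k x => [x|k IH x] /=; first by rewrite mul0r subr_ge0.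
move=> [f [Lf xf /IH fy]]; rewrite -natr1 mulrDl mul1r.
by have := Hd _ Lf; lra.
Qed.

Lemma pack_max d : 0 < d -> (forall f, L f -> d <= f b - f a) ->
  exists N : R -> R -> nat,
    forall x y, x <= y -> pack (N x y) x y /\ forall k, pack k x y -> (k <= N x y)%N.
Proof.
move=> d0 Hd; suff /choice[N HN] : forall xy : R * R, exists n, xy.1 <= xy.2 ->
    pack n xy.1 xy.2 /\ forall k, pack k xy.1 xy.2 -> (k <= n)%N.
  by exists (fun x y => N (x, y)) => x y xy; exact: (HN (x, y)).
move=> [x y] /=; have [xy|] := pselect (x <= y); last by exists 0%N.
have exP : exists k, `[< pack k x y >] by exists 0%N; apply/asboolP.
have ubP k : `[< pack k x y >] -> (k <= Num.bound ((y - x) / d))%N.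
  move/asboolP => /(pack_bound Hd); rewrite -ler_pdivlMr// => h.
  by rewrite -(ler_nat R) (le_trans h)// ltW// archi_boundP// divr_ge0 ?subr_ge0// ltW.
case: (ex_maxnP exP ubP) => n /asboolP Pn nmax; exists n => _; split => // k Pk.
exact/nmax/asboolP.
Qed.

(** The maximal size of a packing is exactly invariant, since packings are carried forward by [f]
    and back by its inverse. *)
Lemma pack_number d : 0 < d -> (forall f, L f -> d <= f b - f a) ->
  exists N : R -> R -> nat,
  [/\ forall x y k, x <= y -> pack k x y -> (k <= N x y)%N,
      forall f x y, L f -> x <= y -> N (f x) (f y) = N x y &
      forall x y z, x <= y -> y <= z ->
        (N x y + N y z <= N x z <= N x y + N y z + 1)%N].
Proof.
move=> d0 Hd; have [N HN] := pack_max d0 Hd; exists N; split.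
- by move=> x y k xy Pk; have [_] := HN _ _ xy; exact.
- move=> f x y Lf xy; have fxy : f x <= f y by rewrite lg_le.
  have [g Lg [fg gf]] := lg_inv HL Lf.
  have [P1 M1] := HN _ _ xy; have [P2 M2] := HN _ _ fxy.
  apply/eqP; rewrite eqn_leq; apply/andP; split.
    by apply: M1; have := pack_act Lg P2; rewrite !fg.
  by apply: M2; exact: pack_act.
- move=> x y z xy yz; have xz := le_trans xy yz.
  have [P1 M1] := HN _ _ xy; have [P2 M2] := HN _ _ yz; have [P3 M3] := HN _ _ xz.
  apply/andP; split; first by apply: M3; exact: pack_cat P1 P2.
  have [i [j [Pi Pj h]]] := pack_split xy yz P3.
  by apply: leq_trans h _; rewrite leq_add2r leq_add ?M1 ?M2.
Qed.

End Packing.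

Lemma pack_sub a b a' b' k x y : a <= a' -> b' <= b -> pack a b k x y -> pack a' b' k x y.
Proof.
move=> aa bb; elim: k x => //= k IH x [f [Lf xf fy]]; exists f; split => //.
  by apply: le_trans xf _; rewrite lg_le.
by apply: IH; apply: pack_extendl fy; rewrite lg_le.
Qed.

(** * Infinite orbits and the contraction of short intervals *)

Definition infinite_orbits := forall (z : R) (s : seq R),
  exists2 f, L f & forall p, p \in s -> f z - p \isn't a Num.int.

(** By continuity a small neighbourhood of z is carried near each listed orbit point; separators [q]
    between consecutive points keep the images disjoint. *)
Lemma pack_orbit z s x y : path <%R x s -> last x s < y ->
  (forall p, p \in s -> exists2 f, L f & p = f z) ->
  exists2 e, 0 < e & pack (z - e) (z + e) (size s) x y.
Proof.
elim: s x => [|p s IH] x /=.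
  by move=> _ xy _; exists 1 => //=; exact: ltW.
move=> /andP[xp ps] sy Hs; have [f Lf pE] := Hs p (mem_head _ _).
have [q pq [qs sy']] : exists2 q, p < q & path <%R q s /\ last q s < y.
  case: s ps sy {IH Hs} => [_ /= py|r s /= /andP[pr rs] sy].
    by exists ((p + y) / 2); [|split => //]; lra.
  by exists ((p + r) / 2); [|split => //; rewrite rs andbT]; lra.
have [e e0 He] := IH q qs sy' (fun r rs => Hs r (mem_behead (s := p :: s) rs)).
have [d d0 Hd] : exists2 d, 0 < d & forall t, `|t - z| < d -> x < f t < q.
  have m0 : 0 < Num.min (p - x) (q - p) by rewrite lt_min; apply/andP; split; lra.
  have [d d0 Hd] := lg_cont z Lf m0; exists d => // t /Hd.
  by rewrite lt_min !ltr_norml -pE; lra.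
exists (Num.min e (d / 2)); first by rewrite lt_min e0/=; lra.
have m1 : Num.min e (d / 2) <= e by rewrite ge_min lexx.
have m2 : Num.min e (d / 2) <= d / 2 by rewrite ge_min lexx orbT.
have m3 : 0 < Num.min e (d / 2) by rewrite lt_min e0/=; lra.
set m := Num.min _ _ in m1 m2 m3 *; exists f; split => //.
  by have /andP[/ltW] : x < f (z - m) < q by apply: Hd; rewrite ltr_norml; lra.
apply: (@pack_extendl _ _ _ q).
  by have /andP[_ /ltW] : x < f (z + m) < q by apply: Hd; rewrite ltr_norml; lra.
by apply: pack_sub He; lra.
Qed.

Lemma orbit_points z n : infinite_orbits -> exists s : seq R,
  [/\ size s = n, uniq s, forall p, p \in s -> 0 < p < 1 &
      forall p, p \in s -> exists2 f, L f & p = f z].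
Proof.
move=> Loo; elim: n => [|n [s [sn us s01 sL]]]; first by exists [::].
have [f Lf fs] := Loo z (0 :: s); have [j /andP[j0 j1]] := exists_int_shift (f z).
exists (f z + j%:~R :: s); split => /=.
- by rewrite sn.
- rewrite us andbT; apply/negP => /[dup] h /(mem_behead (s := 0 :: s))/fs/negP; apply.
  by rewrite opprD addrA subrr add0r rpredN intr_int.
- move=> p; rewrite inE => /predU1P[->|/s01//]; rewrite j1 andbT lt_neqAle j0 andbT.
  apply/negP => /eqP /esym h; have /negP := fs 0 (mem_head _ _); apply.
  by rewrite subr0 -[f z](addrK j%:~R) h sub0r rpredN intr_int.
- move=> p; rewrite inE => /predU1P[->|/sL//].
  by exists ((fun x => x + j%:~R) \o f) => //; apply: (lg_comp HL _ Lf); exact: lg_trans.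
Qed.

Lemma pack_infinite z n : infinite_orbits ->
  exists2 e, 0 < e & pack (z - e) (z + e) n 0 1.
Proof.
move=> /(orbit_points z n)[s [sn us s01 sL]].
pose t := sort <=%R s.
have ts : t =i s by exact: mem_sort.
have -> : n = size t by rewrite size_sort.
apply: pack_orbit.
- rewrite path_min_sorted; first by rewrite lt_sorted_uniq_le sort_uniq us sort_le_sorted.
  by apply/allP => p; rewrite ts => /s01/andP[].
- have := mem_last 0 t; rewrite inE => /predU1P[->//|].
  by rewrite ts => /s01/andP[].
- by move=> p; rewrite ts; exact: sL.
Qed.

Definition contractible u v := forall e, 0 < e -> exists2 f, L f & f v - f u < e.

(** Otherwise non-contractible intervals of length at most 1/(n+1) exist for all n. Every
    neighbourhood of a limit z of their left ends contains one, so packing numbers for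
    neighbourhoods of z are defined, and they are unbounded by [pack_infinite]. *)
Lemma contractible_small : infinite_orbits -> ~ (exists F, invariant_cdf F) ->
  exists2 l, 0 < l & forall u v, u <= v -> v <= u + l -> contractible u v.
Proof.
move=> Loo noF; apply: contrapT => Hl; apply: noF.
have H n : exists uv : R * R, [/\ 0 <= uv.1 <= 1, uv.1 <= uv.2,
    uv.2 <= uv.1 + n.+1%:R^-1 & exists2 d, 0 < d & forall f, L f -> d <= f uv.2 - f uv.1].
  apply: contrapT => Hn; apply: Hl; exists n.+1%:R^-1; first by rewrite invr_gt0.
  move=> u v uv vu e e0; apply: contrapT => He; apply: Hn.
  have [j /andP[j0 j1]] := exists_int_shift u.
  exists (u + j%:~R, v + j%:~R) => /=.
  split; [lra|lra|by rewrite addrAC lerD2r|exists e => // f Lf].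
  rewrite !(per_int j _ (lg_per HL Lf)) leNgt; apply/negP => h; apply: He; exists f => //; lra.
have {H} /choice[w Hw] := H.
have [U UU Uoo] := free_ultrafilter.
have [z _ wz] : exists2 p, 0 <= p <= 1 & ulim U (fun n => (w n).1) p.
  by apply: ulim_ex => n; have [] := Hw n.
have noncontr e : 0 < e -> exists2 d, 0 < d & forall f, L f -> d <= f (z + e) - f (z - e).
  (* One half is for the distance from z to the left end, the other for the length of the
     interval. *)
  move=> e0; have e2 : 0 < e / 2 by lra.
  have [n [/=]] := filter_ex (filterI (wz _ e2) (ulim_small Uoo e2)).
  have [w01 w12 wn [d d0 Hd]] := Hw n; rewrite ltr_norml; set r := n.+1%:R^-1 in wn * => we ne.
  exists d => // f Lf; apply: le_trans (Hd f Lf) _.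
  by apply: lerB; rewrite lg_le//; lra.
have H n : exists N : R -> R -> nat,
    [/\ (n < N 0%R 1%R)%N, forall f x y, L f -> x <= y -> N (f x) (f y) = N x y &
      forall x y z, x <= y -> y <= z ->
        (N x y + N y z <= N x z <= N x y + N y z + 1)%N].
  have [e e0 Pe] := pack_infinite z n.+1 Loo; have [d d0 Hd] := noncontr _ e0.
  have [N [N1 N2 N3]] := pack_number d0 Hd.
  by exists N; split => //; exact: N1.
have {H} /choice[N HN] := H.
by apply: (@quasi_additive_limit N) => [n|n|n]; have [] := HN n.
Qed.


(** * Pointwise limits of lifts *)

(** The closure of [L] for pointwise convergence. Its members are nondecreasing, but may jump or be
    constant on intervals. *)
Definition lclosure (phi : R -> R) := forall (s : seq R) e, 0 < e ->
  exists2 f, L f & forall x, x \in s -> `|f x - phi x| < e.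

Lemma lclosure_sub f : L f -> lclosure f.
Proof. by move=> Lf s e e0; exists f => // x _; rewrite subrr normr0. Qed.

Lemma lclosure_le phi : lclosure phi -> {homo phi : x y / x <= y}.
Proof.
move=> cphi x y xy; rewrite leNgt; apply/negP => h.
have e0 : 0 < (phi x - phi y) / 2 by lra.
have [f Lf Hf] := cphi [:: x; y] _ e0.
have := Hf x; have := Hf y; rewrite !inE !eqxx orbT !ltr_norml.
have : f x <= f y by rewrite lg_le.
by move=> h1 /(_ isT) h2 /(_ isT); lra.
Qed.

Lemma lclosure_per phi x : lclosure phi -> phi (x + 1) = phi x + 1.
Proof.
move=> cphi; apply/eqP; rewrite -subr_eq0 -normr_le0 leNgt; apply/negP => h.
have e0 : 0 < `|phi (x + 1) - (phi x + 1)| / 2 by lra.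
have [f Lf Hf] := cphi [:: x; x + 1] _ e0.
have := Hf x; have := Hf (x + 1); rewrite !inE !eqxx orbT (lg_per HL)//.
move=> /(_ isT) h1 /(_ isT) h2; move: h h1 h2.
have -> : phi (x + 1) - (phi x + 1) = (f x - phi x) - (f x + 1 - phi (x + 1)) by ring.
set P := f x - phi x; set Q := f x + 1 - _ => h1 h2 h3.
by have := ler_normB P Q; lra.
Qed.

(** As [psi] may be discontinuous, its approximant [f] is fixed first; continuity of [f] then tells
    how closely [phi] must be approximated. *)
Lemma lclosure_comp psi phi : lclosure psi -> lclosure phi -> lclosure (psi \o phi).
Proof.
move=> cpsi cphi s e e0; have e2 : 0 < e / 2 by lra.
have [f Lf Hf] := cpsi (map phi s) _ e2.
have [d d0 Hd] : exists2 d, 0 < d & forall x y, x \in s -> `|y - phi x| < d ->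
    `|f y - f (phi x)| < e / 2.
  elim: s {Hf} => [|x s [d d0 Hd]]; first by exists 1.
  have [d' d'0 Hd'] := lg_cont (phi x) Lf e2.
  exists (Num.min d d'); first by rewrite lt_min d0.
  move=> z y; rewrite inE lt_min => /predU1P[->|zs] /andP[y1 y2]; first exact: Hd'.
  exact: Hd.
have [g Lg Hg] := cphi s _ d0.
exists (f \o g); first exact: (lg_comp HL).
move=> x xs /=; have := Hf _ (map_f phi xs); have := Hd _ _ xs (Hg _ xs).
have -> : f (g x) - psi (phi x) = (f (g x) - f (phi x)) + (f (phi x) - psi (phi x)) by ring.
by have := ler_normD (f (g x) - f (phi x)) (f (phi x) - psi (phi x)); lra.
Qed.

(** The bound at 0 and periodicity confine each [f n x] to an interval independent of n. *)
Lemma lclosure_lim (U : set_system nat) (f : nat -> R -> R) : UltraFilter U ->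
  (forall n, L (f n)) -> (forall n, 0 <= f n 0 < 1) ->
  exists2 phi, lclosure phi & forall x, ulim U (f^~ x) (phi x).
Proof.
move=> UU Lf f0.
have /choice[phi Hphi] : forall x, exists p, ulim U (f^~ x) p.
  move=> x; pose p := Num.bound `|x|.
  have xp : `|x| < p%:R by exact: archi_boundP.
  have [|q _ Hq] := @ulim_ex _ U UU (- p%:R) (1 + p%:R) (f^~ x); last by exists q.
  move=> n; move: xp; rewrite ltr_norml => /andP[x1 x2].
  have : f n (0 + (- p%:Z)%:~R) <= f n x by rewrite lg_le// rmorphN/= add0r ltW.
  have : f n x <= f n (0 + p%:Z%:~R) by rewrite lg_le// add0r ltW.
  by rewrite !(per_int _ _ (lg_per HL (Lf n))) rmorphN/=; have := f0 n; rewrite -pmulrn; lra.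
exists phi => // s e e0.
suff : U [set n | forall x, x \in s -> `|f n x - phi x| < e].
  by move=> /filter_ex[n Hn]; exists (f n).
elim: s => [|x s IH]; first by apply: (@filterS _ U _ setT) => //; exact: filterT.
apply: filterS (filterI (Hphi x _ e0) IH) => n [/= h1 h2] y.
by rewrite inE => /predU1P[->|/h2].
Qed.

Definition collapsible u v := exists2 psi, lclosure psi & psi u = psi v.

Lemma contractible_collapsible u v : u <= v -> contractible u v -> collapsible u v.
Proof.
move=> uv cuv; have [U UU Uoo] := free_ultrafilter.
have /choice[f Hf] : forall n, exists f, [/\ L f, 0 <= f 0 < 1 & f v - f u < n.+1%:R^-1].
  move=> n; have [|f Lf fuv] := cuv n.+1%:R^-1; first by rewrite invr_gt0.
  have [j Hj] := exists_int_shift (f 0); exists ((fun x => x + j%:~R) \o f); split => //.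
    by apply: (lg_comp HL _ Lf); exact: lg_trans.
  by rewrite /= opprD addrACA subrr addr0.
have [phi cphi Hphi] := lclosure_lim UU (fun n => let: And3 h _ _ := Hf n in h)
  (fun n => let: And3 _ h _ := Hf n in h).
exists phi => //; apply: (ulim_eq UU (Hphi u) (Hphi v)) => e e0.
apply: filterS (ulim_small Uoo e0) => n /= ne; have [Lf _ fuv] := Hf n.
apply: le_lt_trans ne; rewrite distrC ger0_norm ?subr_ge0 ?lg_le//; exact: ltW.
Qed.

(** * Collapsing the cells of a grid *)

Section Grid.
Variable M : nat.
Let pt (k : nat) : R := k%:R / M.+1%:R.

(* The image of a rigid cell is long, which bounds their number independently of M. *)
Definition rigid_cells (phi : R -> R) : {set 'I_M.+1} :=
  [set k : 'I_M.+1 | ~~ `[< collapsible (phi (pt k)) (phi (pt k.+1)) >]].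

Lemma rigid_cells_comp psi phi : lclosure psi ->
  rigid_cells phi \subset rigid_cells (psi \o phi).
Proof.
move=> cpsi; apply/fintype.subsetP => k; rewrite !inE; apply: contraNN => /asboolP[chi cchi h].
by apply/asboolP; exists (chi \o psi) => //; exact: lclosure_comp.
Qed.

Lemma pt_le j k : (j <= k)%N -> pt j <= pt k.
Proof. by move=> jk; rewrite /pt ler_pM2r ?invr_gt0// ler_nat. Qed.

(** The images of all cells have total length 1, and each rigid one is longer than l. *)
Lemma card_rigid_cells l phi : 0 < l -> lclosure phi ->
  (forall u v, u <= v -> v <= u + l -> contractible u v) ->
  #|rigid_cells phi|%:R * l <= 1.
Proof.
move=> l0 cphi Hl.
have s1 : \sum_(k < M.+1) (phi (pt k.+1) - phi (pt k)) = 1.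
  rewrite -(big_mkord xpredT (fun k => phi (pt k.+1) - phi (pt k))) telescope_sumr//.
  rewrite /pt mul0r divff ?pnatr_eq0// -[X in phi X - _](add0r 1) lclosure_per//; lra.
rewrite -[leRHS]s1 mulr_natl -sumr_const [leRHS](bigID (mem (rigid_cells phi)))/=.
apply: ler_wpDr.
  by apply: sumr_ge0 => k _; rewrite subr_ge0 lclosure_le// pt_le.
apply: ler_sum => k; rewrite inE => /asboolPn nk; rewrite leNgt; apply/negP => h.
have kk : phi (pt k) <= phi (pt k.+1) by rewrite lclosure_le// pt_le.
apply: nk; apply: contractible_collapsible => //; apply: Hl => //; lra.
Qed.

(** If [phi] has the most rigid cells, composing on the left cannot change that set; the other cells
    therefore stay collapsible while they are collapsed one by one. *)
Lemma collapse_cells l : 0 < l ->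
  (forall u v, u <= v -> v <= u + l -> contractible u v) ->
  exists phi, [/\ lclosure phi, 0 <= phi 0 < 1 &
    forall k, k \notin rigid_cells phi -> phi (pt k) = phi (pt k.+1)].
Proof.
move=> l0 Hl.
pose P n := `[< exists2 phi, lclosure phi & #|rigid_cells phi| = n >].
have exP : exists n, P n.
  exists #|rigid_cells id|; apply/asboolP; exists id => //; apply: lclosure_sub.
  have -> : id = (fun x : R => x + 0%:~R) by apply/funext => x; rewrite addr0.
  exact: (lg_trans HL).
have ubP n : P n -> (n <= M.+1)%N.
  by move=> /asboolP[phi _ <-]; rewrite -[leqRHS]card_ord max_card.
case: (ex_maxnP exP ubP) => n /asboolP[phi cphi phin] nmax.
have rigE psi : lclosure psi -> rigid_cells (psi \o phi) = rigid_cells phi.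
  move=> cpsi; apply/esym/eqP; rewrite eqEcard rigid_cells_comp//= phin.
  by apply: nmax; apply/asboolP; exists (psi \o phi) => //; exact: lclosure_comp.
have collapse (s : seq 'I_M.+1) : {subset s <= ~: rigid_cells phi} -> exists2 psi,
    lclosure psi & forall k, k \in s -> psi (phi (pt k)) = psi (phi (pt k.+1)).
  elim: s => [|k s IH] sB.
    by have [f Lf _] := cphi [::] 1 ltr01; exists f => //; exact: lclosure_sub.
  have [|psi cpsi Hpsi] := IH; first by move=> j js; apply: sB; rewrite inE js orbT.
  have := sB k (mem_head _ _); rewrite inE -(rigE _ cpsi) !inE negbK => /asboolP[chi cchi hchi].
  exists (chi \o psi); first exact: lclosure_comp.
  by move=> j; rewrite inE => /predU1P[->//|js] /=; rewrite Hpsi.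
have [|psi cpsi Hpsi] := collapse (enum (~: rigid_cells phi)).
  by move=> k; rewrite mem_enum.
have [j Hj] := exists_int_shift (psi (phi 0)).
pose t x : R := x + j%:~R; have Lt : lclosure t by apply: lclosure_sub; exact: (lg_trans HL).
have ct : lclosure (t \o psi) by exact: lclosure_comp.
exists ((t \o psi) \o phi); split => //; first exact: lclosure_comp.
by move=> k; rewrite rigE// => kB; rewrite /= Hpsi// mem_enum inE.
Qed.

End Grid.

(** A collapsed [phi] takes at grid points only the value [phi 0] and its values at right ends of
    rigid cells. Some [f] in [L] close to [phi] on the grid is squeezed near such a value over each
    other cell. That [K] is independent of [n] is the point. *)
Lemma grid_contraction l : 0 < l ->
  (forall u v, u <= v -> v <= u + l -> contractible u v) ->
  exists K : nat, forall n, exists (f : R -> R) (A V : 'I_K -> R),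
    [/\ L f, forall i, 0 <= A i <= 1, forall i, 0 <= V i <= 2 &
      forall x, 0 <= x < 1 -> (exists i, `|x - A i| <= n.+1%:R^-1) \/
        (exists i, `|f x - V i| <= n.+1%:R^-1)].
Proof.
(* The extra slot holds [phi 0]. *)
move=> l0 Hl; exists (Num.bound l^-1).+1 => n.
pose pt (k : nat) : R := k%:R / n.+1%:R.
have [phi [cphi /andP[phi0 phi1] Hphi]] := collapse_cells n l0 Hl.
set B := rigid_cells n phi in Hphi.
have cB : (#|B| < (Num.bound l^-1).+1)%N.
  rewrite ltnS -(ler_nat R); apply/ltW/(le_lt_trans _ (archi_boundP _)).
    by rewrite -[leRHS]mul1r ler_pdivlMr// card_rigid_cells.
  by rewrite invr_ge0 ltW.
pose sA : seq R := [seq pt (k : 'I_n.+1) | k <- enum B].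
pose sV : seq R := phi 0 :: [seq phi (pt (k : 'I_n.+1).+1) | k <- enum B].
have sizeA : (size sA < (Num.bound l^-1).+1)%N by rewrite size_map -cardE.
have sizeV : (size sV <= (Num.bound l^-1).+1)%N by rewrite /= size_map -cardE.
have pt_01 k : (k <= n.+1)%N -> 0 <= pt k <= 1.
  by move=> kn; rewrite /pt divr_ge0//= ler_pdivrMr// mul1r ler_nat.
have sA01 p : p \in sA -> 0 <= p <= 1.
  by move=> /mapP[k _ ->]; apply: pt_01; exact: ltnW.
have sV02 p : p \in sV -> 0 <= p <= 2.
  rewrite inE => /predU1P[->|/mapP[k _ ->]]; first by lra.
  have /andP[k0 k1] := pt_01 k.+1 (ltn_ord k).
  have := lclosure_le cphi k0; have := lclosure_le cphi k1.
  have := lclosure_per 0 cphi; rewrite add0r; lra.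
have valV k : (k <= n.+1)%N -> phi (pt k) \in sV.
  elim: k => [_|k IH kn]; first by rewrite /pt mul0r mem_head.
  have [kB|kB] := boolP (Ordinal kn \in B).
    by rewrite inE; apply/orP; right; apply/mapP; exists (Ordinal kn) => //; rewrite mem_enum.
  by have := Hphi _ kB; rewrite /= -/(pt k) -/(pt k.+1) => <-; exact/IH/ltnW.
have n0 : 0 < n.+1%:R^-1 :> R by rewrite invr_gt0.
have [f Lf Hf] := cphi [seq pt k | k <- iota 0 n.+2] _ n0.
have Hf' k : (k <= n.+1)%N -> `|f (pt k) - phi (pt k)| < n.+1%:R^-1.
  by move=> kn; apply: Hf; apply: map_f; rewrite mem_iota.
(* Indices past the end of a list give 0, which respects the bounds. *)
exists f, (fun i => nth 0 sA i), (fun i => nth 0 sV i); split => //.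
- move=> i; have [h|h] := ltnP i (size sA); first by apply: sA01; exact: mem_nth.
  by rewrite nth_default// lexx ler01.
- move=> i; have [h|h] := ltnP i (size sV); first by apply: sV02; exact: mem_nth.
  by rewrite nth_default// lexx ler0n.
move=> x /andP[x0 x1]; pose k := Num.truncn (x * n.+1%:R).
have /andP[k1 k2] : k%:R <= x * n.+1%:R < k.+1%:R.
  by apply: truncn_itv; rewrite mulr_ge0.
have kn : (k < n.+1)%N.
  by rewrite -(ltr_nat R) (le_lt_trans k1)// -[ltRHS]mul1r ltr_pM2r.
have xk : pt k <= x by rewrite /pt ler_pdivrMr.
have kx : x <= pt k.+1 by rewrite /pt ler_pdivlMr// ltW.
have ptS : pt k.+1 = pt k + n.+1%:R^-1 by rewrite /pt -natr1 mulrDl mul1r.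
have [kB|kB] := boolP (Ordinal kn \in B).
  left; have pA : pt k \in sA by apply/mapP; exists (Ordinal kn) => //; rewrite mem_enum.
  have iA : (index (pt k) sA < (Num.bound l^-1).+1)%N.
    by apply: leq_trans (leqW _) sizeA; rewrite index_mem.
  exists (Ordinal iA); by rewrite /= nth_index// ger0_norm ?subr_ge0// lerBlDl -ptS.
right; have pV : phi (pt k) \in sV by exact/valV/ltnW.
have iV : (index (phi (pt k)) sV < (Num.bound l^-1).+1)%N.
  by apply: leq_trans _ sizeV; rewrite index_mem.
have kV : phi (pt k) = phi (pt k.+1) by exact: Hphi kB.
exists (Ordinal iV); rewrite /= nth_index//; set r := n.+1%:R^-1 in Hf' *.
have := Hf' _ (ltnW kn); have := Hf' _ kn.
rewrite -kV; set p := pt k in kV *; set q := pt k.+1 in kV *.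
have : f p <= f x by rewrite lg_le.
have : f x <= f q by rewrite lg_le.
rewrite !ltr_norml ler_norml; lra.
Qed.

(** With [K] fixed, the points [A n i] and [V n i] converge along an ultrafilter as the mesh tends
    to 0; [sA] and [sV] collect the limits. *)
Lemma quasi_contraction : infinite_orbits -> ~ (exists F, invariant_cdf F) ->
  exists sA sV : seq R, forall e, 0 < e -> exists2 f, L f &
    forall x, 0 <= x < 1 -> (exists2 p, p \in sA & `|x - p| < e) \/
      (exists2 q, q \in sV & `|f x - q| < e).
Proof.
move=> Loo noF; have [l l0 Hl] := contractible_small Loo noF.
have [K H] := grid_contraction l0 Hl.
have {H} /choice[f /choice[A /choice[V H]]] := H.
have [U UU Uoo] := free_ultrafilter.
have /choice[al Hal] : forall i, exists p, ulim U (A^~ i) p.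
  by move=> i; have [|p _ Hp] := @ulim_ex _ U UU 0 1 (A^~ i); [move=> n; have [] := H n|exists p].
have /choice[be Hbe] : forall i, exists p, ulim U (V^~ i) p.
  by move=> i; have [|p _ Hp] := @ulim_ex _ U UU 0 2 (V^~ i); [move=> n; have [] := H n|exists p].
exists (map al (enum 'I_K)), (map be (enum 'I_K)) => e e0; have e2 : 0 < e / 2 by lra.
have UA : U [set n | forall i, `|A n i - al i| < e / 2].
  by apply: filter_forall => i; exact: Hal.
have UV : U [set n | forall i, `|V n i - be i| < e / 2].
  by apply: filter_forall => i; exact: Hbe.
have [n [[/= nA nV] /=]] := filter_ex (filterI (filterI UA UV) (ulim_small Uoo e2)).
have [Lf _ _ Hn] := H n; set r := n.+1%:R^-1 in Hn * => re.
exists (f n) => // x /Hn[[i xi]|[i xi]]; [left; exists (al i)|right; exists (be i)].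
- by apply: map_f; rewrite mem_enum.
- have -> : x - al i = (x - A n i) + (A n i - al i) by ring.
  by have := ler_normD (x - A n i) (A n i - al i); have := nA i; lra.
- by apply: map_f; rewrite mem_enum.
- have -> : f n x - be i = (f n x - V n i) + (V n i - be i) by ring.
  by have := ler_normD (f n x - V n i) (V n i - be i); have := nV i; lra.
Qed.

End Dynamics.

(** * The circle and lifts of its homeomorphisms *)

Section CircleTopology.
Variable R : realType.
Local Open Scope quotient_scope.
Local Notation T := (circle R).

Definition circ (x : R) : T := \pi_(circle R) x.

Lemma circ_surj (z : T) : exists x, circ x = z.
Proof. by exists (repr z); rewrite /circ reprK. Qed.

Lemma circP (x y : R) : reflect (circ x = circ y) (x - y \is a Num.int).
Proof. apply: (iffP idP) => [h|/eqmodP//]; exact/eqmodP. Qed.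

Lemma circ_eq (x y : R) : circ x = circ y <-> exists j : int, x = y + j%:~R.
Proof.
split=> [/circP/intrP[j h]|[j ->]]; first by exists j; rewrite -h addrC subrK.
by apply/circP; rewrite addrC addKr intr_int.
Qed.

Lemma circDz x (j : int) : circ (x + j%:~R) = circ x.
Proof. by apply/circ_eq; exists j. Qed.

Lemma circ_continuous : continuous circ.
Proof. exact: pi_continuous. Qed.

Lemma nbhs_circ (x : R) (A : set T) :
  nbhs (circ x) A <-> exists2 e : R, 0 < e & forall y, `|y - x| < e -> A (circ y).
Proof.
split.
  move=> /circ_continuous/nbhs_ballP[e /= e0 He]; exists e => // y yx.
  by apply: He; rewrite -ball_normE/= distrC.
move=> [e e0 He]; rewrite nbhsE; exists (circ @` [set y | `|y - x| < e]); last first.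
  by move=> _ [y yx <-]; exact: He.
split; last by exists x => //=; rewrite subrr normr0.
suff : open (circ @^-1` (circ @` [set y | `|y - x| < e])) by [].
rewrite openE => y [a /= ax /esym/circ_eq[j ->]].
apply/nbhs_ballP; exists (e - `|a - x|); first by rewrite /= subr_gt0.
move=> z; rewrite -ball_normE/= => zy; exists (z - j%:~R).
  rewrite /=; have -> : z - j%:~R - x = (a - x) - (a + j%:~R - z) by ring.
  by have := ler_normB (a - x) (a + j%:~R - z); lra.
by rewrite -[z in RHS](subrK j%:~R) circDz.
Qed.

Lemma circ_inj (x y : R) : circ x = circ y -> `|x - y| < 1 -> x = y.
Proof.
move=> /circ_eq[j ->]; rewrite addrAC subrr add0r -intr_norm -[1]/(1%:~R) ltr_int.
by move=> j1; have -> : j = 0; [lia|rewrite addr0].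
Qed.

Lemma circ_rep (c : R) (z : T) : exists2 y, c <= y < c + 1 & circ y = z.
Proof.
have [x <-] := circ_surj z; exists (x + (- Num.floor (x - c))%:~R); last exact: circDz.
rewrite rmorphN/=; have := floor_le (x - c); have := floorD1_gt (x - c); rewrite intrD/=; lra.
Qed.

Lemma lift_glue (G : R -> T) (c : R) (h : R -> R) :
  (forall x (j : int), G (x + j%:~R) = G x) -> circ c = G 0 ->
  (forall t, 0 < t < 1 -> c < h t < c + 1 /\ circ (h t) = G t) ->
  {in `]0, 1[ &, {homo h : x y / x < y}} ->
  exists f : R -> R, [/\ {homo f : x y / x < y}, forall x, f (x + 1) = f x + 1 &
    forall x, circ (f x) = G x].
Proof.
move=> Gper cG hG hmono; pose k t := if t == 0 then c else h t.
have k0 : k 0 = c by rewrite /k eqxx.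
have kb t : 0 <= t < 1 -> c <= k t < c + 1.
  move=> t01; rewrite /k; have [_|t0] := eqVneq t 0; first by lra.
  have [] := hG t; [by rewrite lt_neqAle eq_sym t0|lra].
have kmono s t : 0 <= s -> s < t -> t < 1 -> k s < k t.
  move=> s0 st t1; have tn0 : t != 0 by rewrite gt_eqF//; lra.
  have [t0 _] : c < h t < c + 1 /\ circ (h t) = G t by apply: hG; lra.
  rewrite /k (negbTE tn0); have [_|sn0] := eqVneq s 0; first by lra.
  have s0' : 0 < s by rewrite lt_neqAle eq_sym sn0.
  by apply: hmono => //; rewrite in_itv/=; lra.
have kG t : 0 <= t < 1 -> circ (k t) = G t.
  move=> /andP[t0 t1]; rewrite /k; have [->//|tn0] := eqVneq t 0.
  by have [] := hG t; first by rewrite lt_neqAle eq_sym tn0 t0.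
pose n (x : R) : R := (Num.floor x)%:~R.
have fl x : n x <= x < n x + 1.
  by have := floor_le x; have := floorD1_gt x; rewrite intrD/= /n; lra.
exists (fun x => k (x - n x) + n x); split.
- move=> x y xy; have := fl x; have := fl y => fy fx.
  have nxy : Num.floor x <= Num.floor y by rewrite floor_ge_int (le_trans _ (ltW xy))// floor_le.
  move: nxy; rewrite le_eqVlt => /predU1P[nE|nlt].
    have nyx : n y = n x by rewrite /n nE.
    rewrite nyx in fy *; rewrite ltrD2r; apply: kmono; lra.
  have n1 : n x + 1 <= n y by rewrite /n -[1]/(1%:~R) -intrD ler_int; lia.
  have := kb (x - n x); have := kb (y - n y); lra.
- by move=> x; rewrite /n floorDrz ?rpred1// floor1 intrD/= opprD addrACA subrr addr0 addrA.
- move=> x; rewrite circDz kG; last by have := fl x; lra.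
  by rewrite -[RHS](Gper x (- Num.floor x)) rmorphN.
Qed.

(** Over (0, 1), injectivity keeps the representative in [c, c + 1) away from c, so it varies
    continuously; being injective, it is monotone. *)
Lemma injective_lift (G : R -> T) :
  continuous G -> (forall x (j : int), G (x + j%:~R) = G x) ->
  (forall x y, G x = G y -> circ x = circ y) ->
  (exists f : R -> R, [/\ {homo f : x y / x < y}, forall x, f (x + 1) = f x + 1 &
    forall x, circ (f x) = G x]) \/
  (exists f : R -> R, [/\ {homo f : x y / x < y}, forall x, f (x + 1) = f x + 1 &
    forall x, circ (f x) = G (- x)]).
Proof.
move=> cG Gper Ginj; have [c cE] := circ_surj (G 0).
have /choice[h Hh] : forall x, exists y, c <= y < c + 1 /\ circ y = G x.
  by move=> x; have [y cy yG] := circ_rep c (G x); exists y.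
have h01 t : 0 < t < 1 -> c < h t < c + 1.
  move=> t01; have [/andP[h1 h2] hG] := Hh t; rewrite h2 andbT lt_neqAle h1 andbT.
  apply/negP => /eqP ch; have t1 : `|t - 0| < 1 by rewrite subr0 ger0_norm; lra.
  have /circ_inj : circ t = circ 0 by apply: Ginj; rewrite -hG -ch.
  by move=> /(_ t1) t0; move: t01; rewrite t0 ltxx.
have hcont : {within `]0, 1[, continuous h}.
  suff hc (t : R) : 0 < t < 1 -> h x @[x --> t] --> h t.
    by apply: continuous_in_subspaceT => t; rewrite inE/= in_itv/=; exact: hc.
  move=> t01.
  have ht := h01 _ t01; have [_ hG] := Hh t.
  apply/cvgrPdist_lt => e e0.
  pose d := Num.min e (Num.min (h t - c) (c + 1 - h t)).
  have d0 : 0 < d by rewrite !lt_min e0/=; lra.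
  have [de dc] : d <= e /\ (d <= h t - c /\ d <= c + 1 - h t).
    by rewrite /d !ge_min !lexx !orbT.
  have : nbhs (G t) (circ @` [set y | `|y - h t| < d]).
    by rewrite -hG; apply/nbhs_circ; exists d => // y yd; exists y.
  move=> /(cG t)/nbhs_ballP[r r0 Hr]; exists r => // s /Hr[y /= yd yG].
  have [hs hsG] := Hh s.
  have hy : `|h s - y| < 1 by move: yd; rewrite !ltr_norml; lra.
  have -> : h s = y by apply: circ_inj hy; rewrite hsG.
  by rewrite distrC (lt_le_trans yd).
have hinj : {in `]0, 1[ &, injective h}.
  move=> s t; rewrite !in_itv/= => s01 t01 hst; apply: circ_inj.
    by apply: Ginj; have [_ <-] := Hh s; have [_ <-] := Hh t; rewrite hst.
  by rewrite ltr_norml; lra.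
have [hm|hm] := itv_continuous_inj_mono hcont hinj; [left|right].
  apply: (lift_glue Gper cE (h := h)) => // t t01; split; first exact: h01.
  by have [] := Hh t.
(* For decreasing h, the reflection x |-> G (- x) falls under [lift_glue]. *)
have G1 t : G (1 - t) = G (- t) by rewrite addrC -[1]/(1%:~R) Gper.
apply: (@lift_glue (fun x => G (- x)) c (fun t => h (1 - t))).
- by move=> x j; rewrite opprD -rmorphN Gper.
- by rewrite oppr0.
- move=> t t01; split; first by apply: h01; lra.
  by rewrite -G1; have [] := Hh (1 - t).
- move=> s t; rewrite !in_itv/= => s01 t01 st.
  by apply: hm; rewrite ?in_itv/=; lra.
Qed.

End CircleTopology.

Arguments circ {R} x.

(** * Free subgroups by ping-pong *)

Section Neumann.
Variables (T : ptopologicalType) (G : groupClosed (homeo T)).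
Hypothesis Goo : forall (z : T) (s : seq T), exists2 g : homeo T, g \in G & g z \notin s.

(** B. H. Neumann's argument, by induction on [A]: if no element moves [a :: A] off [B], each b has
    a finite set [E] such that moving [A] off [E] forbids [g a = b]. Moving [A] off all these sets
    and [B] is then a contradiction. *)
Lemma orbit_separation (A B : seq T) :
  exists2 g : homeo T, g \in G & forall a, a \in A -> g a \notin B.
Proof.
elim: A B => [|a A IH] B; first by exists 1%g => //; exact: gpred1.
apply: contrapT => noG.
have meetB g : g \in G -> exists2 x, x \in a :: A & g x \in B.
  move=> gG; apply: contrapT => h; apply: noG; exists g => // x xA.
  by apply/negP => xB; apply: h; exists x.
have avoid b : exists E : seq T, forall g : homeo T, g \in G ->
    (forall x, x \in A -> g x \notin E) -> g a != b.
  apply: contrapT => noE.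
  have moveE (E : seq T) : exists g : homeo T,
      [/\ g \in G, forall x, x \in A -> g x \notin E & g a = b].
    apply: contrapT => h; apply: noE; exists E => g gG gE.
    by apply/eqP => gb; apply: h; exists g.
  (* Otherwise there are arbitrarily many g with g a = b and pairwise disjoint g A; if h *)
  (* moves b out of B, each of the disjoint sets h (g A) must still meet B.              *)
  have [h hG hb] := Goo b B.
  have [F [uF sF FB]] : exists F : seq T,
      [/\ uniq F, size F = (size B).+1 & {subset F <= B}].
    elim: (size B).+1 => [|m [F [uF sF FB]]]; first by exists [::].
    have [g [gG gF ga]] := moveE (map (homeo_inv h) F).
    have [x] := meetB (h * g)%g (gpredM _ _ hG gG).
    rewrite inE => /predU1P[->|xA] hgx.
      by move: hb; rewrite -ga hgx.
    exists (h (g x) :: F); split => /=; [|by rewrite sF|].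
      rewrite uF andbT; apply: contra (gF _ xA) => hgF.
      by rewrite -[g x](@homeo_funK _ h) map_f.
    by move=> y; rewrite inE => /predU1P[->|/FB].
  by have := uniq_leq_size uF FB; rewrite sF ltnn.
have [E HE] : exists E : seq T, forall g : homeo T, g \in G ->
    (forall x, x \in A -> g x \notin E) -> g a \notin B.
  elim: B {IH noG meetB} => [|b B [E HE]]; first by exists [::].
  have [E' HE'] := avoid b; exists (E' ++ E) => g gG gE.
  rewrite inE negb_or HE ?HE'// => x xA; have := gE _ xA;
    by rewrite mem_cat negb_or => /andP[].
have [g gG gE] := IH (E ++ B); apply: noG; exists g => // x.
rewrite inE => /predU1P[->|xA]; last by have := gE _ xA; rewrite mem_cat negb_or => /andP[].
by apply: HE => // y yA; have := gE _ yA; rewrite mem_cat negb_or => /andP[].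
Qed.

End Neumann.

Section PingPong.
Variables (T : ptopologicalType) (G : groupClosed (homeo T)).
Variable F : 'I_2 -> homeo T.
Hypothesis FG : forall i, F i \in G.

Definition letter_homeo (a : 'I_2 * bool) : homeo T :=
  if a.2 then F a.1 else (F a.1)^-1%g.

Definition word_homeo (w : seq ('I_2 * bool)) : homeo T :=
  foldr (fun a g => letter_homeo a * g)%g 1%g w.

Lemma letter_homeoV a : letter_homeo (letter_inv a) = (letter_homeo a)^-1%g.
Proof. by case: a => i [] /=; rewrite /letter_homeo /= ?invgK. Qed.

Lemma word_homeo_reduced_cons a w :
  word_homeo (reduced_cons a w) = (letter_homeo a * word_homeo w)%g.
Proof.
case: w => [|b w] //=; case: eqP => [->|//].
by rewrite letter_homeoV mulgA mulgV mul1g.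
Qed.

Lemma word_homeoM u v : word_homeo (word_mul u v) = (word_homeo u * word_homeo v)%g.
Proof.
by elim: u => [|a u IH] /=; [rewrite mul1g|rewrite word_homeo_reduced_cons IH mulgA].
Qed.

Lemma word_homeo_in w : word_homeo w \in G.
Proof.
elim: w => [|a w IH] /=; first exact: gpred1.
apply: gpredM IH; rewrite /letter_homeo; case: a.2 => //.
by rewrite gpredV.
Qed.

Definition free_group_homeo (w : free_group 'I_2) : homeo T := word_homeo w.

Lemma free_group_homeoM : {morph free_group_homeo : u v / (u * v)%g >-> (u * v)%g}.
Proof. by move=> u v; exact: word_homeoM. Qed.

HB.instance Definition _ := isMultiplicative.Build _ _ free_group_homeo free_group_homeoM.

Definition free_group_range : {pred homeo T} :=
  fun g => `[< exists w, g = free_group_homeo w >].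

Lemma free_group_range_mul : mulg_closed free_group_range.
Proof.
move=> g h /asboolP[u ->] /asboolP[v ->]; apply/asboolP; exists (u * v)%g.
by rewrite free_group_homeoM.
Qed.

Lemma free_group_range1 : 1%g \in free_group_range.
Proof. by apply/asboolP; exists 1%g. Qed.

Lemma free_group_rangeV : invg_closed free_group_range.
Proof.
move=> g /asboolP[u ->]; apply/asboolP; exists (u^-1)%g.
apply: (@mulgI _ (free_group_homeo u)).
by rewrite mulgV -free_group_homeoM mulgV.
Qed.

HB.instance Definition _ := isMulClosed.Build _ free_group_range free_group_range_mul.
HB.instance Definition _ := isMul1Closed.Build _ free_group_range free_group_range1.
HB.instance Definition _ := isInvClosed.Build _ free_group_range free_group_rangeV.

Variables (U : 'I_2 * bool -> set T) (p : T).
Hypothesis Up : forall a, ~ U a p.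
Hypothesis Udisj : forall a b x, U a x -> U b x -> a = b.
Hypothesis Umap : forall a x, ~ U (letter_inv a) x -> U a (letter_homeo a x).

Lemma word_homeo_ping a w : reduced (a :: w) -> U a (word_homeo (a :: w) p).
Proof.
elim: w a => [|b w IH] a /=; first by move=> _; apply: Umap; exact: Up.
move=> /andP[ba rw]; apply: Umap => h.
by move/negP: ba; apply; apply/eqP; apply: Udisj h; exact: IH.
Qed.

(** A non-empty reduced word sends [p] into the set of its first letter, which misses [p], so it is
    not the identity. *)
Lemma ping_pong : contains_free_subgroup2 G.
Proof.
pose H : groupClosed (homeo T) := GroupClosed.clone _ free_group_range _.
exists H; split.
  by move=> g /asboolP[w ->]; exact: word_homeo_in.
pose phi : {multiplicative free_group 'I_2 -> homeo T} :=
  Multiplicative.clone _ _ free_group_homeo _.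
exists phi; split.
- by move=> w _; apply/asboolP; exists w.
- move=> u v _ _ uv.
  pose w := (u^-1 * v)%g; have hw : free_group_homeo w = 1%g.
    have {}uv : free_group_homeo u = free_group_homeo v by exact: uv.
    by rewrite free_group_homeoM -uv -free_group_homeoM mulVg.
  have w0 : word w = [::].
    case E : (word w) => [//|a s]; have := word_reduced w.
    rewrite E => /word_homeo_ping; rewrite -E; move: hw; rewrite /free_group_homeo => ->.
    by move/Up.
  have w1 : w = 1%g by exact: val_inj.
  by rewrite -[RHS](mulVKg u) -/w w1 mulg1.
- by move=> g /asboolP[w ->]; exists w.
Qed.

End PingPong.

(** * Free subgroups from quasi-contractions *)

Section FreeSubgroup.
Variables (T : ptopologicalType) (G : groupClosed (homeo T)).
Hypothesis T2 : hausdorff_space T.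
Hypothesis Goo : forall (z : T) (s : seq T), exists2 g : homeo T, g \in G & g z \notin s.

Definition nbhs_seq (s : seq T) (U : set T) := forall x, x \in s -> nbhs x U.

Definition quasi_contracting (A B : seq T) := forall U V, nbhs_seq A U -> nbhs_seq B V ->
  exists2 g : homeo T, g \in G & forall x, ~ U x -> V (g x).

Lemma nbhs_seqI s U V : nbhs_seq s U -> nbhs_seq s V -> nbhs_seq s (U `&` V).
Proof. by move=> sU sV x xs; apply: filterI; [exact: sU|exact: sV]. Qed.

Lemma nbhs_seq_map (g : homeo T) s U :
  nbhs_seq (map g s) U -> nbhs_seq s (g @^-1` U).
Proof. by move=> sU x xs; apply: (homeo_fun_continuous (h := g)); apply: sU; exact: map_f. Qed.

Lemma nbhs_seq_cat s t U : nbhs_seq (s ++ t) U -> nbhs_seq s U /\ nbhs_seq t U.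
Proof. by move=> stU; split=> x xs; apply: stU; rewrite mem_cat xs ?orbT. Qed.

Lemma separate_seq (s t : seq T) : (forall x, x \in s -> x \notin t) ->
  exists U V, [/\ nbhs_seq s U, nbhs_seq t V & forall x, U x -> V x -> False].
Proof.
have sep1 x r : x \notin r ->
    exists U V, [/\ nbhs x U, nbhs_seq r V & forall x, U x -> V x -> False].
  elim: r => [_|y r IH]; first by exists setT, set0; split => //; exact: filterT.
  rewrite inE negb_or => /andP[xy /IH[U [V [xU rV UV]]]].
  move: T2; rewrite open_hausdorff => /(_ _ _ xy)[[U' V'] /= [xU' yV']].
  move=> [oU' oV' /eqP/seteqP[UV' _]].
  exists (U `&` U'), (V `|` V'); split.
  - by apply: filterI => //; apply: open_nbhs_nbhs; split => //; exact/set_mem.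
  - move=> z; rewrite inE => /predU1P[->|/rV]; last by apply: filterS => w; left.
    suff : nbhs y V' by apply: filterS => w; right.
    by apply: open_nbhs_nbhs; split => //; exact/set_mem.
  - by move=> z [Uz U'z] [/(UV _ Uz)//|V'z]; exact: (UV' z).
elim: s => [_|x s IH st]; first by exists set0, setT; split => // y _; exact: filterT.
have [|U [V [sU tV UV]]] := IH; first by move=> y ys; apply: st; rewrite inE ys orbT.
have [U' [V' [xU' tV' UV']]] := sep1 x t (st x (mem_head _ _)).
exists (U `|` U'), (V `&` V'); split; last 1 first.
- by move=> z [Uz|U'z] [Vz V'z]; [exact: UV Vz|exact: UV' V'z].
- move=> z; rewrite inE => /predU1P[->|/sU]; last by apply: filterS => w; left.
  by apply: filterS xU' => w; right.
- exact: nbhs_seqI.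
Qed.

(** Once [B] is off [A], an element [k] moves their union [C] off itself. A strong contraction [f]
    acts near [C], its conjugate by [k] near [C'], and the two play ping-pong. *)
Lemma free_subgroup (A B : seq T) : quasi_contracting A B -> contains_free_subgroup2 G.
Proof.
move=> GAB; have [h hG hB] := orbit_separation Goo B A.
pose B' := map h B.
have {}GAB : quasi_contracting A B'.
  move=> U V AU /nbhs_seq_map BV; have [g gG gUV] := GAB _ _ AU BV.
  by exists (h * g)%g; [exact: gpredM|exact: gUV].
have AB' x : x \in A -> x \notin B'.
  by move=> xA; apply/negP => /mapP[b bB xb]; move/negP: (hB b bB); rewrite -xb.
have [k kG kC] := orbit_separation Goo (A ++ B') (A ++ B').
set C := A ++ B' in kC; pose C' := map k C.
have [q qG pC] := Goo point (C ++ C'); set p := q point in pC.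
have [U1 [V1 [AU1 BV1 UV1]]] := separate_seq AB'.
have [|W [W' [CW CW' WW']]] := @separate_seq C C'.
  by move=> x xC; apply/negP => /mapP[y yC xy]; move/negP: (kC y yC); rewrite -xy.
have [|P [Q [CP pQ PQ]]] := @separate_seq (C ++ C') [:: p].
  by move=> x xC; rewrite inE; apply: contraNneq pC => <-.
have nPp : ~ P p by move=> Pp; apply: PQ Pp _; apply: nbhs_singleton; apply: pQ; exact: mem_head.
have [CP1 /nbhs_seq_map CP2] := nbhs_seq_cat CP.
have CR : nbhs_seq C (W `&` P `&` k @^-1` (W' `&` P)).
  exact: nbhs_seqI (nbhs_seqI CW CP1) (nbhs_seqI (nbhs_seq_map CW') CP2).
(* Subsets of [S] lie in [W], their images under [k] lie in [W'], and both miss [p]. *)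
set S := W `&` P `&` k @^-1` (W' `&` P) in CR; have [AS BS] := nbhs_seq_cat CR.
have [f fG fUV] := GAB _ _ (nbhs_seqI AU1 AS) (nbhs_seqI BV1 BS).
(* [D true] attracts for [f] and [D false] for its inverse; [y] transports both to the conjugate. *)
pose D (b : bool) := if b then V1 `&` S else U1 `&` S.
have DS b x : D b x -> S x by case: b => -[].
pose F (i : 'I_2) : homeo T := if i == 0 then f else (k * f * k^-1)%g.
pose y (i : 'I_2) x := if i == 0 then x else (k^-1)%g x.
have FG i : F i \in G by rewrite /F; case: ifP => // _; rewrite !gpredM// gpredV.
have fD b x : ~ D (~~ b) x -> D b ((if b then f else f^-1%g) x).
  case: b => /=; first exact: fUV.
  by move=> nV; apply: contrapT => /fUV; rewrite (homeo_invK f).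
apply: (@ping_pong _ _ F FG (fun a x => D a.2 (y a.1 x)) p) => /=.
- move=> [i b] /= /DS; rewrite /y; case: ifP => _; first by move=> [[_]].
  by move=> [_ [_]]; rewrite (homeo_invK k).
- move=> [i b] [j c] x /=.
  have WD i' b' : D b' (y i' x) -> if i' == 0 then W x else W' x.
    move=> /DS; rewrite /y; case: ifP => _; first by move=> [[]].
    by move=> [_ []]; rewrite (homeo_invK k).
  move=> Di Dj; have := WD _ _ Di; have := WD _ _ Dj.
  have [ij|ij] := eqVneq i j.
    move=> _ _; rewrite ij in Di *.
    by case: b c Di Dj => [] [] // [h1 _] [h2 _]; [case: (UV1 _ h2 h1)|case: (UV1 _ h1 h2)].
  by case: i j ij {Di Dj} => [[|[|//]] ?] [[|[|//]] ?]//= _ h1 h2;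
    [case: (WW' _ h2 h1)|case: (WW' _ h1 h2)].
- move=> [i b] x /=; rewrite /y /letter_homeo /F /=; case: ifP => _; first exact: fD.
  move=> /fD; case: b => /=; first by rewrite (homeo_funK k).
  by rewrite (homeo_funK k).
Qed.

End FreeSubgroup.

(** * Orientation, and the group of lifts *)

Section Orientation.
Variable R : realType.
Local Notation T := (circle R).
Implicit Types g h : homeo T.

Lemma circle_hausdorff : hausdorff_space T.
Proof.
move=> p q; have [x <-] := circ_surj p; have [y] := circ_rep (x - 1 / 2) q.
move=> yx <- clq; apply: contrapT => xy.
have e0 : 0 < `|x - y| / 2.
  by rewrite divr_gt0// normr_gt0 subr_eq0; apply: contra_notN xy => /eqP->.
have [] := clq (circ @` [set z | `|z - x| < `|x - y| / 2])
    (circ @` [set z | `|z - y| < `|x - y| / 2]).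
- by apply/nbhs_circ; exists (`|x - y| / 2) => // z zx; exists z.
- by apply/nbhs_circ; exists (`|x - y| / 2) => // z zx; exists z.
move=> _ [[u /= ux <-] [v /= vy /esym/circ_inj]].
have xy1 : `|x - y| <= 1 / 2 by rewrite ler_norml; lra.
have E : x - y = (v - y) - (u - x) + (u - v) by ring.
have h3 := ler_normB (v - y) (u - x); have h4 := ler_normD ((v - y) - (u - x)) (u - v).
have E' : u - v = (u - x) - (v - y) + (x - y) by ring.
have h5 := ler_normD ((u - x) - (v - y)) (x - y); have h6 := ler_normB (u - x) (v - y).
rewrite -E in h4; rewrite -E' in h5.
have -> : `|u - v| < 1 by lra.
move=> /(_ isT) uv; have uv0 : `|u - v| = 0 by rewrite uv subrr normr0.
lra.
Qed.

Definition lift (g : T -> T) (f : R -> R) :=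
  [/\ {homo f : x y / x < y}, forall x, f (x + 1) = f x + 1 &
    forall x, circ (f x) = g (circ x)].

Definition orientation_preserving g := exists f, lift g f.

Lemma orientation_cases g : orientation_preserving g \/
  exists f : R -> R, [/\ {homo f : x y / x < y}, forall x, f (x + 1) = f x + 1 &
    forall x, circ (f x) = g (circ (- x))].
Proof.
apply: (@injective_lift R (g \o circ (R := R))).
- move=> x; apply: continuous_comp; [exact: circ_continuous|exact: homeo_fun_continuous].
- by move=> x j /=; rewrite circDz.
- by move=> x y /= /(can_inj (homeo_funK g)).
Qed.

Lemma lift1 (j : int) : lift idfun (fun x => x + j%:~R).
Proof.
split=> [x y xy|x|x]; [by rewrite ltrD2r|by rewrite addrAC|exact: circDz].
Qed.

Lemma lift_comp g h f k : lift g f -> lift h k -> lift (g \o h) (f \o k).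
Proof.
move=> [f1 f2 f3] [k1 k2 k3]; split => x /=.
- by move=> y xy; apply/f1/k1.
- by rewrite k2 f2.
- by rewrite f3 k3.
Qed.

(** [f] is onto because [g] is and [f] commutes with integer shifts. *)
Lemma lift_inv g f : lift g f ->
  exists2 k, lift (homeo_inv g) k & cancel f k /\ cancel k f.
Proof.
move=> [f1 f2 f3].
have /choice[k fk] : forall y, exists x, f x = y.
  move=> y; have [x xy] := circ_surj (homeo_inv g (circ y)).
  have : circ y = circ (f x) by rewrite f3 xy homeo_invK.
  by move=> /circ_eq[j ->]; exists (x + j%:~R); rewrite per_int.
have fmono : {mono f : x y / x < y} by apply/leW_mono/le_mono.
have finj : injective f by apply: (inc_inj (le_mono f1)).
have kf : cancel f k by move=> x; apply: finj; rewrite fk.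
exists k => //; split => [x y xy|x|x].
- by rewrite -fmono !fk.
- by apply: finj; rewrite f2 !fk.
- by apply: (can_inj (homeo_funK g)); rewrite homeo_invK -f3 fk.
Qed.

Lemma orientation_preserving1 : orientation_preserving 1%g.
Proof. by exists (fun x => x + 0%:~R); exact: lift1. Qed.

Lemma orientation_preservingM g h : orientation_preserving g ->
  orientation_preserving h -> orientation_preserving (g * h)%g.
Proof. by move=> [f gf] [k hk]; exists (f \o k); exact: lift_comp. Qed.

Lemma orientation_preservingV g :
  orientation_preserving g -> orientation_preserving (g^-1)%g.
Proof. by move=> [f /lift_inv[k gk _]]; exists k. Qed.

(** The two reflections cancel in the composite lift. *)
Lemma orientation_reversingM g h : ~ orientation_preserving g ->
  ~ orientation_preserving h -> orientation_preserving (g * h)%g.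
Proof.
have [//|[f [f1 f2 f3]] _] := orientation_cases g.
have [//|[k [k1 k2 k3]] _] := orientation_cases h.
exists (fun x => f (- k (- x))); split => x.
- by move=> y xy; apply: f1; rewrite ltrN2; apply: k1; rewrite ltrN2.
- have := k2 (- (x + 1)); rewrite opprD subrK => ->.
  by rewrite opprD -f2 subrK//.
- by rewrite f3 opprK k3 opprK.
Qed.

Section Subgroup.
Variable G : groupClosed (homeo T).

Definition orientation_subgroup : {pred homeo T} :=
  fun g => (g \in G) && `[< orientation_preserving g >].

Lemma orientation_subgroupP g :
  reflect (g \in G /\ orientation_preserving g) (g \in orientation_subgroup).
Proof. by apply: (iffP andP) => -[gG /asboolP go]. Qed.

Lemma orientation_subgroup_mul : mulg_closed orientation_subgroup.
Proof.
move=> g h /orientation_subgroupP[gG go] /orientation_subgroupP[hG ho].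
by apply/orientation_subgroupP; split; [exact: gpredM|exact: orientation_preservingM].
Qed.

Lemma orientation_subgroup1 : 1%g \in orientation_subgroup.
Proof. by apply/orientation_subgroupP; split; [exact: gpred1|exact: orientation_preserving1]. Qed.

Lemma orientation_subgroupV : invg_closed orientation_subgroup.
Proof.
move=> g /orientation_subgroupP[gG go].
by apply/orientation_subgroupP; split; [rewrite gpredV|exact: orientation_preservingV].
Qed.

HB.instance Definition _ := isMulClosed.Build _ orientation_subgroup orientation_subgroup_mul.
HB.instance Definition _ := isMul1Closed.Build _ orientation_subgroup orientation_subgroup1.
HB.instance Definition _ := isInvClosed.Build _ orientation_subgroup orientation_subgroupV.

End Subgroup.

Section Lifts.
Variable G : groupClosed (homeo T).

Definition lifts : set (R -> R) := [set f | exists2 g, g \in G & lift g f].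

Lemma lifts_group : lift_group lifts.
Proof.
split.
- by move=> f [g gG [f1 _ _]]; apply/leW_mono/le_mono.
- by move=> f [g gG []].
- move=> f k [g gG gf] [h hG hk]; exists (g * h)%g; first exact: gpredM.
  exact: lift_comp.
- move=> f [g gG /lift_inv[k gk fk]]; exists k => //; exists (g^-1)%g => //.
  by rewrite gpredV.
- by move=> j; exists 1%g; [exact: gpred1|exact: lift1].
Qed.

Hypothesis Gor : forall g, g \in G -> orientation_preserving g.

Lemma lifts_infinite_orbits :
  (forall (z : T) (s : seq T), exists2 g : homeo T, g \in G & g z \notin s) ->
  infinite_orbits lifts.
Proof.
move=> Goo z s; have [g gG gz] := Goo (circ z) (map circ s).
have [f gf] := Gor gG; exists f; first by exists g.
move=> p ps; apply: contraNN gz => /circP fp; apply/mapP; exists p => //.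
by rewrite -fp; have [_ _ ->] := gf.
Qed.

Lemma nbhs_seq_circ (s : seq R) (U : set T) : nbhs_seq (map circ s) U ->
  exists2 e, 0 < e & forall x y, x \in s -> `|y - x| < e -> U (circ y).
Proof.
elim: s => [|x s IH] /= sU; first by exists 1.
have [|e e0 He] := IH; first by move=> y ys; apply: sU; rewrite inE ys orbT.
have /nbhs_circ[d d0 Hd] := sU _ (mem_head _ _).
exists (Num.min e d); first by rewrite lt_min e0.
move=> z y; rewrite inE lt_min => /predU1P[->|zs] /andP[h1 h2]; first exact: Hd.
exact: He h1.
Qed.

Lemma free_or_invariant_cdf :
  (forall (z : T) (s : seq T), exists2 g : homeo T, g \in G & g z \notin s) ->
  contains_free_subgroup2 G \/ exists F, invariant_cdf lifts F.
Proof.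
move=> Goo; have [|noF] := pselect (exists F, invariant_cdf lifts F); first by right.
left; have [sA [sV AV]] := quasi_contraction lifts_group (lifts_infinite_orbits Goo) noF.
apply: (free_subgroup circle_hausdorff Goo (A := map circ sA)
  (B := map circ sV)).
move=> U V /nbhs_seq_circ[e e0 eU] /nbhs_seq_circ[d d0 dV].
have [|f [g gG [_ _ gf]] Hf] := AV (Num.min e d); first by rewrite lt_min e0.
exists g => // z nUz; have [x x01 xz] := circ_rep 0 z; rewrite add0r in x01.
have [[p pA]|[q qV]] := Hf x x01; rewrite lt_min => /andP[h1 h2].
  by case: nUz; rewrite -xz; exact: eU h1.
by rewrite -xz -gf; exact: dV h2.
Qed.

End Lifts.

End Orientation.

(** * Invariant measures *)

Lemma pushforward_measure d d' (T1 : measurableType d) (T2 : measurableType d')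
    (R : realType) (m : {measure set T1 -> \bar R}) (f : T1 -> T2) :
  measurable_fun setT f ->
  exists nu : {measure set T2 -> \bar R}, forall A, nu A = m (f @^-1` A).
Proof.
move=> mf.
by exists (measure_function_pushforward__canonical__measure_function_Measure m mf).
Qed.

Section RightLimit.
Variables (R : realType) (F : R -> R).
Hypothesis Fle : {homo F : x y / x <= y}.

(** The right-continuous version of [F], as a Stieltjes measure requires. *)
Definition right_limit x := inf (F @` [set y | x < y]).

Lemma right_limit_le x y : x < y -> right_limit x <= F y.
Proof.
move=> xy; apply: ge_inf; last by exists y.
by exists (F x) => _ [z /= xz <-]; exact/Fle/ltW.
Qed.

Lemma right_limit_ge c x : (forall y, x < y -> c <= F y) -> c <= right_limit x.
Proof.
move=> cF; apply: lb_le_inf; first by exists (F (x + 1)), (x + 1) => //=; rewrite ltrDl.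
by move=> _ [y /= xy <-]; exact: cF.
Qed.

Lemma right_limit_nondecreasing : {homo right_limit : x y / x <= y}.
Proof.
by move=> x y xy; apply: right_limit_ge => z yz; apply/right_limit_le/(le_lt_trans xy).
Qed.

Lemma right_limit_right_continuous (x : R) : right_limit y @[y --> x^'+] --> right_limit x.
Proof.
apply/cvgrPdist_lt => e e0.
have [y xy Fy] : exists2 y, x < y & F y < right_limit x + e.
  apply: contrapT => h; have : right_limit x + e <= right_limit x.
    apply: right_limit_ge => y xy; rewrite leNgt; apply/negP => Fy.
    by apply: h; exists y.
  by lra.
near=> z.
have xz : x < z by [].
have zy : z < y by near: z; exact: nbhs_right_lt.
have h1 := right_limit_nondecreasing (ltW xz); have h2 := right_limit_le zy.
rewrite ltr_norml; lra.
Unshelve. all: by end_near. Qed.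

HB.instance Definition _ := isCumulative.Build R _ R right_limit
  right_limit_nondecreasing right_limit_right_continuous.

Lemma right_limit_act f k c : {mono f : x y / x < y} -> cancel f k -> cancel k f ->
  (forall x, F (f x) = F x + c) -> forall x, right_limit (f x) = right_limit x + c.
Proof.
move=> fmono fk kf Fc x; apply/eqP; rewrite eq_le; apply/andP; split.
  rewrite -lerBlDr; apply: right_limit_ge => y xy; rewrite lerBlDr -Fc.
  by apply: right_limit_le; rewrite fmono.
apply: right_limit_ge => y xy; rewrite -[y]kf Fc lerD2r; apply: right_limit_le.
by rewrite -fmono kf.
Qed.

Definition rlsm : {measure set (measurableTypeR R) -> \bar R} :=
  lebesgue_stieltjes_measure right_limit.

Lemma rlsm_itv a b : a <= b -> rlsm `]a, b]%classic = (right_limit b - right_limit a)%:E.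
Proof.
move=> ab; rewrite /rlsm/= /lebesgue_stieltjes_measure /measure_extension/=.
by rewrite measurable_mu_extE//= ?wlength_itv_bnd//; exact: is_ocitv.
Qed.

End RightLimit.

Section StieltjesCircle.
Variables (R : realType) (L : set (R -> R)) (F : R -> R).
Hypotheses (HL : lift_group L) (HF : invariant_cdf L F).

Let Fle : {homo F : x y / x <= y}. Proof. by case: HF. Qed.

Local Notation mu := (rlsm Fle).

Lemma lg_measurable f : L f -> measurable_fun setT (f : measurableTypeR R -> measurableTypeR R).
Proof.
move=> Lf; suff /continuous_measurable_fun h : continuous f by exact: h.
move=> x; apply/cvgrPdist_lt => e e0; have [d d0 Hd] := lg_cont HL x Lf e0.
by exists d => // y /= yx; rewrite distrC; apply: Hd; rewrite distrC.
Qed.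

Lemma lg_preimage_itv f k a b : L f -> L k -> cancel k f ->
  f @^-1` `]a, b]%classic = `]k a, k b]%classic.
Proof.
move=> Lf Lk kf; apply/seteqP; split => x /=; rewrite !in_itv/= -[X in X < f x]kf
  -[X in f x <= X]kf; by rewrite (lg_mono HL Lf) (lg_le HL Lf).
Qed.

(** [F] changes by a constant under [f], so [mu] and its image agree on half-open intervals, which
    determine a Stieltjes measure. *)
Lemma rlsm_invariant f (A : set (measurableTypeR R)) : L f -> measurable A ->
  mu A = mu (f @^-1` A).
Proof.
move=> Lf mA; have [k Lk [fk kf]] := lg_inv HL Lf.
have [nu nuE] := pushforward_measure mu (lg_measurable Lf).
have [_ _ /(_ _ Lf)[c Fc]] := HF.
rewrite -nuE; apply: lebesgue_stieltjes_measure_unique => // _ [[a b] _ <-] /=.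
rewrite nuE; have [ab|ba] := leP a b; last first.
  by rewrite set_itv_ge ?preimage_set0 ?measure0// bnd_simp -leNgt ltW.
rewrite (lg_preimage_itv _ _ Lf Lk kf) -!/(rlsm Fle) !rlsm_itv ?(lg_le HL Lk)//.
have := right_limit_act Fle (lg_mono HL Lf) fk kf Fc.
by move=> Hc; congr EFin; rewrite -[in LHS](kf a) -[in LHS](kf b) !Hc; ring.
Qed.

Lemma rlsm_period (B : set (measurableTypeR R)) u : measurable B ->
  (forall x (j : int), B (x + j%:~R) <-> B x) ->
  mu (B `&` `]u, u + 1]) = mu (B `&` `]0, 1]).
Proof.
move=> mB Bper.
have shift a b (j : int) :
    mu (B `&` `]a + j%:~R, b + j%:~R]) = mu (B `&` `]a, b]).
  rewrite (rlsm_invariant (lg_trans HL j))//; last exact: measurableI.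
  congr (mu _); apply/seteqP; split => x /=; rewrite !in_itv/= ltrD2r lerD2r;
    by move=> [/Bper Bx]; split.
have [j /andP[t0 t1]] := exists_int_shift u.
rewrite -(shift _ _ j) addrAC; set t := u + j%:~R in t0 t1 *.
have split3 a b c : a <= b -> b <= c ->
    mu (B `&` `]a, c]) = (mu (B `&` `]a, b]) + mu (B `&` `]b, c]))%E.
  move=> ab bc; rewrite -measureU; first last.
  - apply/seteqP; split => x //= -[[_]]; rewrite !in_itv/= => /andP[_ xb] [_ /andP[bx _]].
    by move: (lt_le_trans bx xb); rewrite ltxx.
  - exact: measurableI.
  - exact: measurableI.
  congr (mu _); rewrite -setIUr; congr (_ `&` _); apply/seteqP; split => x /=; rewrite !in_itv/=.
    move=> /andP[ax xc]; have [xb|bx] := leP x b; [left|right]; exact/andP.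
  by move=> [/andP[h1 h2]|/andP[h1 h2]]; apply/andP; split => //;
    [exact: le_trans bc|exact: le_lt_trans h1].
(* The piece beyond 1 is a translate of the missing piece from 0 to t. *)
rewrite (split3 t 1 (t + 1)) ?(ltW t1)//; last by rewrite lerDr.
rewrite (split3 0 t 1) ?(ltW t1)// addeC; congr (_ + _)%E.
by rewrite -(shift 0 t 1) add0r.
Qed.

End StieltjesCircle.

(** * Measures on the circle, finite orbits and averaging *)

Section CircleMeasure.
Variable R : realType.
Local Notation T := (circle R).

Lemma circ_measurable : measurable_fun setT (circ : measurableTypeR R -> borel T).
Proof.
apply: (@measurability _ _ (measurableTypeR R) (borel T) setT circ (@open T)) => //.
move=> _ [A oA <-]; rewrite setTI; apply: open_measurable.
by move/continuousP: (@circ_continuous R); exact.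
Qed.

Lemma homeo_measurable (U : ptopologicalType) (g : homeo U) :
  measurable_fun setT (g : borel U -> borel U).
Proof.
apply: (@measurability _ _ (borel U) (borel U) setT g (@open U)) => //.
move=> _ [A oA <-]; rewrite setTI; apply: sub_sigma_algebra.
by have /continuousP := @homeo_fun_continuous _ g; exact.
Qed.

Lemma homeo_image (U : topologicalType) (g : homeo U) (A : set U) :
  g @` A = homeo_sym g @^-1` A.
Proof.
apply/seteqP; split => [_ [x Ax <-]|x Ax] /=; first by rewrite homeo_funK.
by exists (homeo_inv g x) => //; rewrite homeo_invK.
Qed.

Lemma measurable_homeo_image (U : ptopologicalType) (g : homeo U) (A : set (borel U)) :
  measurable A -> measurable (g @` A : set (borel U)).
Proof.
move=> mA; rewrite homeo_image -[X in measurable X]setTI.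
exact: homeo_measurable.
Qed.

Definition invariant (U : ptopologicalType) (G : groupClosed (homeo U))
    (nu : set (borel U) -> \bar R) :=
  forall g : homeo U, g \in G -> forall A : set (borel U), measurable A ->
    nu (g @` A) = nu A.

Lemma normalize_invariant (U : ptopologicalType) (G : groupClosed (homeo U))
    (nu : {measure set (borel U) -> \bar R}) :
  (0 < nu setT)%E -> (nu setT < +oo)%E -> invariant G nu ->
  exists mu : probability (borel U) R, invariant_measure G mu.
Proof.
move=> nu0 nuoo nuG.
(* The default [dirac point] is returned only for total mass 0 or infinity, both excluded here. *)
have E (B : set (borel U)) :
    mnormalize nu (dirac point) B = (nu B * ((fine (nu setT))^-1)%:E)%E.
  rewrite /mnormalize; case: ifPn => [/orP[]/eqP nuT|//].
    by rewrite nuT ltxx in nu0.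
  by rewrite nuT ltxx in nuoo.
exists (mnormalize nu (dirac point)) => g gG A mA.
by apply: etrans (E _) _; rewrite nuG//; exact: esym (E A).
Qed.

(** The Stieltjes measure on ]0, 1] is pushed to the circle. Pulling back by a lift replaces ]0, 1]
    by another period interval, which [rlsm_period] undoes. *)
Lemma cdf_invariant (G : groupClosed (homeo T)) F :
  (forall g, g \in G -> orientation_preserving g) -> invariant_cdf (lifts G) F ->
  exists nu : {measure set (borel T) -> \bar R}, nu setT = 1%E /\ invariant G nu.
Proof.
move=> Gor HF; have HL := lifts_group G; have [Fle Fper _] := HF.
have m01 : measurable (`]0, 1]%classic : set (measurableTypeR R)) by [].
have [nu nuE] := pushforward_measure (mrestr (rlsm Fle) m01) circ_measurable.
exists nu; split.
  rewrite nuE/= /mrestr preimage_setT setTI rlsm_itv//.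
  have [k Lk [fk kf]] := lg_inv HL (lg_trans HL 1).
  have := right_limit_act Fle (lg_mono HL (lg_trans HL 1)) fk kf Fper 0.
  by rewrite add0r => ->; rewrite addrAC subrr add0r.
move=> g gG A mA; have [f gf] := Gor g gG; have Lf : lifts G f by exists g.
have [k gk [fk kf]] := lift_inv gf.
have Lk : lifts G k by exists (g^-1)%g; rewrite ?gpredV.
have mB : measurable (circ @^-1` A : set (measurableTypeR R)).
  by rewrite -[X in measurable X]setTI; exact: circ_measurable.
rewrite !nuE/= /mrestr.
have -> : circ @^-1` (g @` A) = k @^-1` (circ @^-1` A) :> set R.
  rewrite homeo_image; apply/funext => x /=; have [_ _ ->] := gk; reflexivity.
have mkB : measurable (k @^-1` (circ @^-1` A) : set (measurableTypeR R)).
  by rewrite -[X in measurable X]setTI; exact: (lg_measurable HL Lk).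
rewrite (rlsm_invariant HL HF Lf); last exact: measurableI.
rewrite preimage_setI (lg_preimage_itv HL _ _ Lf Lk kf).
have -> : f @^-1` (k @^-1` (circ @^-1` A)) = circ @^-1` A.
  by apply/funext => x /=; rewrite fk.
rewrite -[in k 1](add0r 1) (lg_per HL Lk); apply: (rlsm_period HL HF) => // x j.
by rewrite /= circDz.
Qed.

Lemma finite_orbit_invariant (U : ptopologicalType) (G : groupClosed (homeo U))
    (z : U) (s : seq U) : (forall g : homeo U, g \in G -> g z \in s) ->
  exists nu : {measure set (borel U) -> \bar R},
    [/\ (0 < nu setT)%E, (nu setT < +oo)%E & invariant G nu].
Proof.
move=> Gzs; pose O := undup [seq x <- s | `[< exists2 g : homeo U, g \in G & x = g z >]].
have memO x : reflect (exists2 g : homeo U, g \in G & x = g z) (x \in O).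
  rewrite mem_undup mem_filter; apply: (iffP andP) => [[/asboolP//]|h].
  by split; [exact/asboolP|case: h => g gG ->; exact: Gzs].
pose nu : {measure set (borel U) -> \bar R} :=
  msum (fun k => dirac (nth z O k : borel U) : {measure set (borel U) -> \bar R}) (size O).
have nuE A : nu A = (\sum_(x <- O) (\1_A x)%:E)%E.
  by rewrite (big_nth z) big_mkord.
have nuT : nu setT = (size O)%:R%:E.
  rewrite nuE sumEFin (eq_bigr (fun=> 1)) => [|x _]; last by rewrite indicT.
  by rewrite big_const_seq count_predT iter_addr_0.
exists nu; rewrite nuT lte_fin ltry ltr0n; split => //.
  have /memO zO : exists2 g : homeo U, g \in G & z = g z by exists 1%g => //; exact: gpred1.
  by rewrite lt0n size_eq0; apply: contraTneq zO => ->.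
move=> g gG A mA; rewrite !nuE.
have -> : (\sum_(x <- O) (\1_A x : R)%:E = \sum_(x <- map (homeo_inv g) O) (\1_A x : R)%:E)%E.
  apply: perm_big; apply: uniq_perm; rewrite ?undup_uniq//.
    by rewrite map_inj_uniq ?undup_uniq//; exact: can_inj (homeo_invK g).
  move=> x; apply/memO/mapP => [[h hG ->]|[_ /memO[h hG ->] ->]].
    exists (g (h z)); last by rewrite homeo_funK.
    by apply/memO; exists (g * h)%g => //; exact: gpredM.
  by exists (g^-1 * h)%g => //; rewrite gpredM// gpredV.
rewrite big_map; apply: eq_bigr => x _; rewrite !indicE; congr ((_ : nat)%:R)%:E.
by congr nat_of_bool; rewrite homeo_image; apply/idP/idP; rewrite !inE.
Qed.

(** With [nu' A = nu A + nu (g0 A)], elements of [H] fix both terms, the second through conjugation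
    by [g0], and the other elements of [G] swap them. *)
Lemma index2_invariant (U : ptopologicalType) (G H : groupClosed (homeo U)) (g0 : homeo U)
    (nu : {measure set (borel U) -> \bar R}) :
  {in G &, forall g h, g \notin H -> h \notin H -> (g * h)%g \in H} ->
  g0 \in G -> g0 \notin H -> invariant H nu ->
  exists nu' : {measure set (borel U) -> \bar R},
    nu' setT = (nu setT + nu setT)%E /\ invariant G nu'.
Proof.
move=> GH g0G g0H nuH.
have mulVH g : g \in G -> g \notin H -> (g * g0^-1)%g \in H.
  by move=> gG gH; apply: GH; rewrite ?gpredV.
have [nu2 nu2E] := pushforward_measure nu (homeo_measurable (g0^-1)%g).
have nu2g A : nu2 A = nu (g0 @` A) by rewrite nu2E homeo_image.
have compE (g h : homeo U) (A : set U) : g @` (h @` A) = (g * h)%g @` A.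
  by rewrite image_comp.
pose nu' : {measure set (borel U) -> \bar R} := measure_add nu nu2.
have nu'E A : nu' A = (nu A + nu2 A)%E by exact: measure_addE.
exists nu'; split; first by rewrite nu'E nu2E preimage_setT.
move=> g gG A mA; rewrite !nu'E !nu2g.
have [gH|gH] := boolP (g \in H).
  rewrite nuH//; congr (_ + _)%E.
  have conjH : (g0 * g * g0^-1)%g \in H.
    by apply: mulVH; [exact: gpredM|rewrite gpredMr].
  rewrite -[RHS](nuH _ conjH); last exact: measurable_homeo_image.
  by rewrite !compE -!mulgA mulVg mulg1.
rewrite addeC; congr (_ + _)%E.
  by rewrite compE nuH//; exact: GH.
rewrite -[RHS](nuH _ (mulVH _ gG gH)); last exact: measurable_homeo_image.
by rewrite compE -mulgA mulVg mulg1.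
Qed.

End CircleMeasure.

Theorem theorem2p5 (R : realType) (G : groupClosed (homeo (circle R))) :
  ~ contains_free_subgroup2 G ->
  exists mu : probability (borel (circle R)) R, invariant_measure G mu.
Proof.
move=> nfree; pose H : groupClosed (homeo (circle R)) :=
  GroupClosed.clone _ (orientation_subgroup G) _.
have Hor g : g \in H -> orientation_preserving g by move/orientation_subgroupP => [].
(* The measure for [H] counts a finite orbit or comes from a distribution function; a free subgroup
   of [H] would lie in [G]. *)
have [nu [nu0 nuoo nuH]] : exists nu : {measure set (borel (circle R)) -> \bar R},
    [/\ (0 < nu setT)%E, (nu setT < +oo)%E & invariant H nu].
  have [Hoo|/existsNP[z /existsNP[s Hzs]]] := pselect (forall (z : circle R) (s : seq (circle R)),
    exists2 g : homeo (circle R), g \in H & g z \notin s); last first.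
    apply: (@finite_orbit_invariant _ _ _ z s) => g gH.
    by apply/negPn/negP => gz; apply: Hzs; exists g.
  have [[K [KH K2]]|[F HF]] := free_or_invariant_cdf Hor Hoo.
    by case: nfree; exists K; split => // g /KH /orientation_subgroupP[].
  have [nu [nu1 nuH]] := cdf_invariant Hor HF.
  by exists nu; rewrite nu1 ltry lte_fin ltr01.
have [[g0 g0G g0H]|Gor] := pselect (exists2 g0, g0 \in G & g0 \notin H); last first.
  apply: (normalize_invariant nu0 nuoo) => g gG A mA; apply: nuH => //.
  by apply: contrapT => /negP gH; apply: Gor; exists g.
have GH : {in G &, forall g h, g \notin H -> h \notin H -> (g * h)%g \in H}.
  have rev k : k \in G -> k \notin H -> ~ orientation_preserving k.
    by move=> kG /negP kH ko; apply: kH; exact/orientation_subgroupP.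
  move=> g h gG hG gH hH; apply/orientation_subgroupP; split; first exact: gpredM.
  by apply: orientation_reversingM; exact: rev.
have [nu' [nu'E nu'G]] := index2_invariant GH g0G g0H nuH.
apply: (normalize_invariant _ _ nu'G); rewrite nu'E; first exact: adde_gt0.
by rewrite lte_add_pinfty.
Qed.
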